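(* Let $K$ be a field and $S=K[x_1,\ldots,x_n]$. Let $\Delta$ be a pure simplicial complex on $[n]$ with Stanley-Reisner ideal $I_\Delta\subseteq S$. Then the following conditions are equivalent: (1) $S/I_\Delta^{(2)}$ satisfies Serre's condition $(S_2)$. (2) $\operatorname{diam}\big((\operatorname{link}_\Delta F)^{(1)}\big)\le 2$ for any face $F\in\Delta$ with $\dim\operatorname{link}_\Delta F\ge 1$.
   Context: A simplicial complex on $V=[n]$ is a nonempty subset $\Delta\subseteq 2^V$ closed under taking subsets and with $\{v\}\in\Delta$ for all $v\in V$; $\dim F=\sharp(F)-1$ for a face $F$, and $\dim\Delta$ is the maximum of these. $\Delta$ is pure if all facets (maximal faces) have the same cardinality. The Stanley-Reisner ideal $I_\Delta$ is generated by all squarefree monomials $x_{i_1}\cdots x_{i_p}$ with $\{i_1<\cdots<i_p\}\notin\Delta$. The second symbolic power is $I_\Delta^{(2)}=\bigcap_F P_F^2$, where $F$ runs over the facets of $\Delta$ and $P_F=(x_i:i\in[n]\setminus F)$. For $k\ge1$, $S/I$ satisfies $(S_k)$ if $\operatorname{depth}(S/I)_P\ge\min\{\dim(S/I)_P,k\}$ for every $P\in\operatorname{Spec}S/I$. For $F\in\Delta$, $\operatorname{link}_\Delta F=\{H\in\Delta:H\cup F\in\Delta,\ H\cap F=\emptyset\}$. For a complex $\Gamma$, $\Gamma^{(1)}=\{F\in\Gamma:\dim F\le 1\}$ is regarded as a graph on the vertices of $\Gamma$ whose edges are the $1$-dimensional faces. The diameter of a connected graph is the maximal distance (minimal length of a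 path) between two vertices, and the diameter of a disconnected graph is $\infty$. *)

(* Defs.v *)
From HB Require Import structures.
From mathcomp Require Import all_boot all_order all_algebra.
From mathcomp Require Import generic_quotient ring_quotient ring.
From mathcomp Require Import boolp.
From mathcomp.multinomials Require Import mpoly.

Set Implicit Arguments.
Unset Strict Implicit.
Unset Printing Implicit Defensive.

Import GRing.Theory.
Local Open Scope ring_scope.
Local Open Scope quotient_scope.

Section IdealOperations.
Variable R : comNzRingType.

Definition ideal_gen (G : R -> Prop) : {pred R} := fun x =>
  `[< exists s : seq (R * R),
        (forall p, p \in s -> G p.2) /\ x = \sum_(p <- s) p.1 * p.2 >].

Definition ideal_mul (I J : {pred R}) : {pred R} :=
  ideal_gen (fun x => exists a b, [/\ a \in I, b \in J & x = a * b]).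

Lemma ideal_gen_sub (G : R -> Prop) x : G x -> x \in ideal_gen G.
Proof.
move=> Gx; apply/asboolP; exists [:: (1, x)]; split.
  by move=> p; rewrite inE => /eqP ->.
by rewrite big_seq1 mul1r.
Qed.

Lemma ideal_gen0 (G : R -> Prop) : 0 \in ideal_gen G.
Proof. by apply/asboolP; exists [::]; rewrite big_nil. Qed.

Lemma ideal_genMD (G : R -> Prop) a x y :
  x \in ideal_gen G -> y \in ideal_gen G -> a * x + y \in ideal_gen G.
Proof.
move=> /asboolP[s [Gs ->]] /asboolP[t [Gt ->]]; apply/asboolP.
exists ([seq (a * p.1, p.2) | p <- s] ++ t); split.
  move=> p; rewrite mem_cat => /orP[/mapP[q qs ->] /=|]; first exact: Gs.
  exact: Gt.
rewrite big_cat big_map /= mulr_sumr; congr (_ + _).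
by apply: eq_bigr => p _; rewrite mulrA.
Qed.

End IdealOperations.

(* The localization R_P, as pairs (numerator, denominator) up to the usual
   equivalence; R may have zero divisors. *)
Section Localization.
Variables (R : comNzRingType) (P : prime_idealr R).

Record locfrac := LocFrac {
  locfrac_val :> R * R;
  locfrac_den : locfrac_val.2 \notin P
}.

HB.instance Definition _ := [isSub for locfrac_val].
HB.instance Definition _ := [Choice of locfrac by <:].

Lemma locfrac_den1 : 1 \notin P.
Proof. by rewrite idealr1. Qed.

Lemma locfrac_denM s t : s \notin P -> t \notin P -> s * t \notin P.
Proof. by rewrite prime_idealrM negb_or => -> ->. Qed.

Definition mkfrac (a s : R) (sP : s \notin P) : locfrac := @LocFrac (a, s) sP.

Definition equivloc (x y : locfrac) : bool :=
  `[< exists2 u, u \notin P & u * (x.1 * y.2 - y.1 * x.2) = 0 >].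

Lemma equivloc_refl : reflexive equivloc.
Proof.
by move=> x; apply/asboolP; exists 1; rewrite ?locfrac_den1 // subrr mulr0.
Qed.

Lemma equivloc_sym : ssrbool.symmetric equivloc.
Proof.
by move=> x y; apply/asboolP/asboolP => -[u uP e]; exists u => //;
   rewrite -opprB mulrN e oppr0.
Qed.

Lemma equivloc_trans : transitive equivloc.
Proof.
move=> y x z /asboolP[u uP eu] /asboolP[v vP ev]; apply/asboolP.
exists (u * v * y.2); first by rewrite !locfrac_denM ?locfrac_den.
transitivity (v * z.2 * (u * (x.1 * y.2 - y.1 * x.2))
            + u * x.2 * (v * (y.1 * z.2 - z.1 * y.2))); first by ring.
by rewrite eu ev !mulr0 addr0.
Qed.

Canonical equivloc_equiv :=
  EquivRel equivloc equivloc_refl equivloc_sym equivloc_trans.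

Definition localization := {eq_quot equivloc}.

HB.instance Definition _ : EqQuotient _ equivloc localization :=
  EqQuotient.on localization.
HB.instance Definition _ := Choice.on localization.

Definition locfrac0 : locfrac := mkfrac 0 locfrac_den1.
Definition locfrac1 : locfrac := mkfrac 1 locfrac_den1.
Definition locfrac_opp (x : locfrac) : locfrac :=
  mkfrac (- x.1) (locfrac_den x).
Definition locfrac_add (x y : locfrac) : locfrac :=
  mkfrac (x.1 * y.2 + y.1 * x.2)
         (locfrac_denM (locfrac_den x) (locfrac_den y)).
Definition locfrac_mul (x y : locfrac) : locfrac :=
  mkfrac (x.1 * y.1) (locfrac_denM (locfrac_den x) (locfrac_den y)).

Definition loc0 : localization := \pi_localization locfrac0.
Definition loc1 : localization := \pi_localization locfrac1.
Definition loc_opp := lift_op1 localization locfrac_opp.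
Definition loc_add := lift_op2 localization locfrac_add.
Definition loc_mul := lift_op2 localization locfrac_mul.

Lemma loc_eqP (x y : locfrac) :
  reflect (exists2 u, u \notin P & u * (x.1 * y.2 - y.1 * x.2) = 0)
          (\pi_localization x == \pi_localization y).
Proof. by rewrite eqmodE; apply: asboolP. Qed.

Lemma loc_eq (x y : locfrac) :
  x.1 * y.2 = y.1 * x.2 -> \pi_localization x = \pi_localization y.
Proof.
by move=> e; apply/eqP/loc_eqP; exists 1; rewrite ?locfrac_den1 // e subrr mulr0.
Qed.

Lemma repr_locP (x : locfrac) : exists2 u, u \notin P &
  u * ((repr (\pi_localization x)).1 * x.2
       - x.1 * (repr (\pi_localization x)).2) = 0.
Proof. by apply/loc_eqP; rewrite reprK. Qed.

Lemma loc_oppE x :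
  loc_opp (\pi_localization x) = \pi_localization (locfrac_opp x).
Proof.
unlock loc_opp; apply/eqP/loc_eqP; have [u uP e] := repr_locP x; exists u => //=.
by rewrite !mulNr -opprD mulrN e oppr0.
Qed.

Lemma loc_addE x y : loc_add (\pi_localization x) (\pi_localization y)
  = \pi_localization (locfrac_add x y).
Proof.
unlock loc_add; apply/eqP/loc_eqP; have [u uP eu] := repr_locP x.
have [v vP ev] := repr_locP y; exists (u * v); first exact: locfrac_denM.
move: (repr _) eu (repr _) ev => x' eu y' ev /=.
transitivity (v * y.2 * y'.2 * (u * (x'.1 * x.2 - x.1 * x'.2))
            + u * x.2 * x'.2 * (v * (y'.1 * y.2 - y.1 * y'.2))); first by ring.
by rewrite eu ev !mulr0 addr0.
Qed.

Lemma loc_mulE x y : loc_mul (\pi_localization x) (\pi_localization y)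
  = \pi_localization (locfrac_mul x y).
Proof.
unlock loc_mul; apply/eqP/loc_eqP; have [u uP eu] := repr_locP x.
have [v vP ev] := repr_locP y; exists (u * v); first exact: locfrac_denM.
move: (repr _) eu (repr _) ev => x' eu y' ev /=.
transitivity (v * y'.1 * y.2 * (u * (x'.1 * x.2 - x.1 * x'.2))
            + u * x.1 * x'.2 * (v * (y'.1 * y.2 - y.1 * y'.2))); first by ring.
by rewrite eu ev !mulr0 addr0.
Qed.

Let locE := (loc_oppE, loc_addE, loc_mulE).

Lemma loc_addA : associative loc_add.
Proof.
elim/quotW => x; elim/quotW => y; elim/quotW => z.
by rewrite !locE; apply: loc_eq => /=; ring.
Qed.

Lemma loc_addC : commutative loc_add.
Proof.
by elim/quotW => x; elim/quotW => y; rewrite !locE; apply: loc_eq => /=; ring.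
Qed.

Lemma loc_add0 : left_id loc0 loc_add.
Proof. by elim/quotW => x; rewrite !locE; apply: loc_eq => /=; ring. Qed.

Lemma loc_addN : left_inverse loc0 loc_opp loc_add.
Proof. by elim/quotW => x; rewrite !locE; apply: loc_eq => /=; ring. Qed.

HB.instance Definition _ :=
  GRing.isZmodule.Build localization loc_addA loc_addC loc_add0 loc_addN.

Lemma loc_mulA : associative loc_mul.
Proof.
elim/quotW => x; elim/quotW => y; elim/quotW => z.
by rewrite !locE; apply: loc_eq => /=; ring.
Qed.

Lemma loc_mulC : commutative loc_mul.
Proof.
by elim/quotW => x; elim/quotW => y; rewrite !locE; apply: loc_eq => /=; ring.
Qed.

Lemma loc_mul1 : left_id loc1 loc_mul.
Proof. by elim/quotW => x; rewrite !locE; apply: loc_eq => /=; ring. Qed.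

Lemma loc_mulDl : left_distributive loc_mul loc_add.
Proof.
elim/quotW => x; elim/quotW => y; elim/quotW => z.
by rewrite !locE; apply: loc_eq => /=; ring.
Qed.

Lemma loc1_neq0 : loc1 != loc0.
Proof.
apply/negP => /loc_eqP[u uP] /=.
by rewrite !mulr1 subr0 mulr1 => u0; rewrite u0 idealr0 in uP.
Qed.

HB.instance Definition _ := GRing.Zmodule_isComNzRing.Build localization
  loc_mulA loc_mulC loc_mul1 loc_mulDl loc1_neq0.

End Localization.

Section SerreCondition.

(* d <= dim A, where dim A is the supremum of the lengths of chains of primes.
   prime_idealr is a type of boolean predicates; with the axioms of boolp
   (which give `[< _ >]) every prime ideal is of this form. *)
Definition krull_dim_ge (A : comNzRingType) (d : nat) : Prop :=
  exists p : 'I_d.+1 -> prime_idealr A,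
    forall i j : 'I_d.+1, (i < j)%N ->
      {subset p i <= p j} /\ exists2 x, x \in p j & x \notin p i.

Definition regular_sequence (A : comNzRingType) (s : seq A) : Prop :=
  (forall i, (i < size s)%N -> forall a,
     a * s`_i \in ideal_gen (fun x => x \in take i s) ->
     a \in ideal_gen (fun x => x \in take i s)) /\
  1 \notin ideal_gen (fun x => x \in s).

(* d <= depth A for a local ring A, whose maximal ideal is its set of
   non-units; depth A is the supremum of the lengths of the regular sequences
   in the maximal ideal. *)
Definition depth_ge (A : comNzRingType) (d : nat) : Prop :=
  exists s : d.-tuple A,
    (forall x, x \in s -> ~ exists y, y * x = 1) /\ regular_sequence s.

(* depth R_P >= min (dim R_P) k, unfolded into: every natural number d with
   d <= k and d <= dim R_P satisfies d <= depth R_P. This also makes sense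
   when dim R_P is infinite. *)
Definition serre_condition (k : nat) (R : comNzRingType) : Prop :=
  forall P : prime_idealr R, forall d : nat,
    (d <= k)%N -> krull_dim_ge (localization P) d ->
    depth_ge (localization P) d.

End SerreCondition.

Section Complexes.
Variable n : nat.

Record simplicial_complex := SimplicialComplex {
  faces :> {set {set 'I_n}};
  faces_neq0 : faces != set0;
  faces_sub : forall F G : {set 'I_n}, F \in faces -> G \subset F -> G \in faces;
  faces_vertex : forall v : 'I_n, [set v] \in faces
}.

Implicit Types (D : {set {set 'I_n}}) (F : {set 'I_n}).

Definition facets D : {set {set 'I_n}} := [set F | maxset (mem D) F].

Definition pure D : Prop := {in facets D &, forall F G : {set _}, #|F| = #|G|}.

Definition link D F : {set {set 'I_n}} :=
  [set H in D | (H :|: F \in D) && (H :&: F == set0)].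

Definition complex_dim D : int := (\max_(F in D) #|F|)%N%:Z - 1.

Definition skeleton_edge D : rel 'I_n :=
  [rel u v | (u != v) && ([set u; v] \in D)].

(* The diameter of the graph D^(1) is at most d. The vertices are the v with
   [set v] in D, not all of 'I_n; a disconnected graph has no finite bound. *)
Definition skeleton_diam_le D (d : nat) : Prop :=
  forall u v : 'I_n, [set u] \in D -> [set v] \in D ->
    exists p : seq 'I_n,
      [/\ path (skeleton_edge D) u p, last u p = v & (size p <= d)%N].

End Complexes.

Section SymbolicSquare.
Variables (K : fieldType) (n : nat).

(* P_F = (x_i : i \notin F) *)
Definition face_ideal (F : {set 'I_n}) : {pred {mpoly K[n]}} :=
  ideal_gen (fun f => exists2 i : 'I_n, i \notin F & f = 'X_i).

(* The second symbolic power of the Stanley-Reisner ideal of D: the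
   intersection of the P_F^2 over the facets F. *)
Definition symbolic_square (D : simplicial_complex n) : {pred {mpoly K[n]}} :=
  fun f => [forall F in facets D, f \in ideal_mul (face_ideal F) (face_ideal F)].

Lemma facets_neq0 (D : simplicial_complex n) : exists F, F \in facets D.
Proof.
have /set0Pn[F0 F0D] := faces_neq0 D.
have [F Fmax _] := maxset_exists (P := mem (faces D)) F0D.
by exists F; rewrite inE.
Qed.

Lemma face_ideal_const (F : {set 'I_n}) (f : {mpoly K[n]}) :
  f \in face_ideal F -> f.@[fun=> 0] = 0.
Proof.
move=> /asboolP[s [Gs ->]]; rewrite rmorph_sum /= big_seq big1 // => p /Gs[i _ ->].
by rewrite mevalM mevalXU mulr0.
Qed.

Lemma symbolic_square_idealr (D : simplicial_complex n) :
  idealr_closed (symbolic_square D).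
Proof.
split.
- by apply/forall_inP => F _; apply: ideal_gen0.
- have [F Ff] := facets_neq0 D; apply/negP => /forall_inP/(_ F Ff).
  move=> /asboolP[s [Gs e]]; have /eqP[] := oner_neq0 K.
  rewrite -(mevalC (fun=> 0) 1 : 1%:MP_[n].@[_] = 1) mpolyC1 e.
  rewrite rmorph_sum /= big_seq big1 // => p /Gs[a [b [_ bP ->]]].
  by rewrite !mevalM (face_ideal_const bP) !mulr0.
- move=> a x y /forall_inP xP /forall_inP yP; apply/forall_inP => F Ff.
  by apply: ideal_genMD; [exact: xP | exact: yP].
Qed.

HB.instance Definition _ (D : simplicial_complex n) :=
  isIdealr.Build {mpoly K[n]} (symbolic_square D) (symbolic_square_idealr D).

End SymbolicSquare.

Arguments symbolic_square K {n} D.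

(* Main.v *)
Require Import Defs.
From HB Require Import structures.
From mathcomp Require Import all_boot all_order all_algebra.
From mathcomp Require Import generic_quotient ring_quotient ring zify.
From mathcomp Require Import boolp.
From mathcomp.multinomials Require Import mpoly.

(* The ideal I = I_D^(2) consists of the f whose monomials have degree at least
   2 outside every facet G, so S/I embeds in the product of the
   Cohen-Macaulay rings S/P_G^2, and a family (e_G) in the product comes from
   S/I exactly when, for each monomial x^a, the coefficients of x^a in the e_G
   agree on the facets G with outside degree of a at most 1.

   Diameter condition => (S_2). Those facets are connected through codimension
   one faces: if G and G' are two of them with |G :&: G'| maximal among
   unconnected pairs, then a path of length at most 2 in the graph of
   link (G :&: G') from a well chosen vertex of G to one of G' produces
   intermediate facets with larger intersections. Hence if f e and g e come
   from S/I, and no codimension one face F has f, g both in P_F, then e comes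
   from S/I. So it suffices to find f, g in the given prime Q that form a
   regular sequence modulo each P_G and are not both in any such P_F. Let
   F = {i | x_i notin Q} and let c be the codimension of F in the facets
   containing it. For c >= 2 take the first two elementary symmetric
   polynomials in the variables outside F; for c = 1 the first one and an
   element of Q outside P_F; for c = 0 two coprime elements, obtained from
   unique factorization.

   (S_2) => diameter condition. If u and v are at distance more than 2 in
   link F, then x_u x_v on the facets through u, extended by 0 on those through
   v, is multiplied into S/I by P_F but does not come from S/I locally at P_F;
   so no two elements of P_F form a regular sequence there. *)

Set Implicit Arguments.
Unset Strict Implicit.
Unset Printing Implicit Defensive.

Import Order.TTheory GRing.Theory Num.Theory.
Local Open Scope ring_scope.

(** * Gauss lemma: unique factorization in polynomial rings *)

Section Factorial.
Variable R : idomainType.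
Implicit Types a b c p x y u : R.

Definition divides a b := exists c, b = c * a.

Definition prime_elt p :=
  [/\ p != 0, p \isn't a GRing.unit &
      forall a b, divides p (a * b) -> divides p a \/ divides p b].

Definition factors_into_primes x :=
  exists s u, [/\ u \is a GRing.unit, forall p, p \in s -> prime_elt p
                & x = u * \prod_(p <- s) p].

Definition factorial_ring := forall x, x != 0 -> factors_into_primes x.

Lemma divides_mull p a b : divides p b -> divides p (a * b).
Proof. by case=> c ->; exists (a * c); rewrite mulrA. Qed.

Lemma divides_mulr p a b : divides p a -> divides p (a * b).
Proof. by rewrite mulrC; apply: divides_mull. Qed.

Lemma prime_elt_unitM u p : u \is a GRing.unit -> prime_elt p -> prime_elt (u * p).
Proof.
move=> uU [p0 pU pP]; split.
- by rewrite mulf_neq0 //; apply: contraTneq uU => ->; rewrite unitr0.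
- by rewrite unitrM uU.
- have div_up a : divides p a -> divides (u * p) a.
    by case=> c ->; exists (c * u^-1); rewrite mulrA mulrVK.
  move=> a b [c e]; have /pP[|] : divides p (a * b).
    by exists (c * u); rewrite e mulrA.
    by left; apply: div_up.
  by right; apply: div_up.
Qed.

Lemma prime_divides_prod p (s : seq R) : prime_elt p ->
  divides p (\prod_(q <- s) q) -> exists2 q, q \in s & divides p q.
Proof.
move=> pP; elim: s => [|q s IHs].
  rewrite big_nil => -[c /esym e]; case: pP => _ /negP[].
  by apply/unitrPr; exists c; rewrite mulrC.
case: pP (IHs) => _ _ pP IH; rewrite big_cons => /pP[pq|/IH[r rs pr]].
  by exists q; rewrite ?mem_head.
by exists r; rewrite // inE rs orbT.
Qed.

Lemma divides_unit p u : u \is a GRing.unit -> divides p u ->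
  p \is a GRing.unit.
Proof. by move=> uU [c e]; move: uU; rewrite e unitrM => /andP[]. Qed.

Lemma prime_divides_primeP p q : prime_elt p -> prime_elt q -> divides p q ->
  exists2 u, u \is a GRing.unit & q = u * p.
Proof.
move=> [p0 pU _] [q0 qU qP] [c e]; exists c => //.
have [|[d ed]|[d ed]] := qP c p; first by exists 1; rewrite mul1r.
  case/negP: pU; apply/unitrPr; exists d; apply: (mulfI q0).
  by rewrite mulr1 {2}e ed; ring.
apply/unitrPr; exists d; apply: (mulfI p0).
by rewrite mulr1 {2}ed e; ring.
Qed.

(** Irreducibility forces the cofactor of the first prime in a factorization of x to be a unit, so x
    is an associate of that prime. *)
Lemma irreducible_prime x : factorial_ring -> x != 0 ->
    x \isn't a GRing.unit ->
    (forall a b, x = a * b -> (a \is a GRing.unit) || (b \is a GRing.unit)) ->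
  prime_elt x.
Proof.
move=> fR x0 xU irr; have [[|p s] [u [uU sP e]]] := fR x x0.
  by move: xU; rewrite e big_nil mulr1 uU.
have pP := sP p (mem_head _ _); rewrite big_cons mulrCA in e.
case/orP: (irr _ _ e) => [pU|vU]; first by case: pP => _; rewrite pU.
by rewrite e mulrC; apply: prime_elt_unitM.
Qed.

Lemma prime_elt_coprime p a b : prime_elt p -> ~ divides p a ->
  divides p (a * b) -> divides p b.
Proof. by case=> _ _ pP pa /pP[]. Qed.

End Factorial.

(** * Factoriality passes from R to R[x] *)

Section FactorialPoly.
Variable R : idomainType.
Hypothesis factR : factorial_ring R.
Implicit Types (c : R) (f g h d q : {poly R}).

(** Content 1, expressed through prime constants in place of a gcd of the coefficients. *)
Let primitive f := forall p : R, prime_elt p -> ~ divides p%:P f.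

(** If p divides f g, it divides the product of the leading coefficients, hence one of them.
    Removing that leading term, a multiple of p, lowers the sum of the sizes. *)
Lemma prime_elt_polyC (p : R) : prime_elt p -> prime_elt p%:P.
Proof.
move=> [p0 pU pP]; split; first by rewrite polyC_eq0.
  by rewrite poly_unitE size_polyC p0 coefC.
move=> f g; have [m] := ubnP (size f + size g)%N.
elim: m f g => // m IHm f g lem pfg.
have [-> | f0] := eqVneq f 0; first by left; exists 0; rewrite mul0r.
have [-> | g0] := eqVneq g 0; first by right; exists 0; rewrite mul0r.
have strip (h : {poly R}) : h != 0 -> divides p (lead_coef h) ->
    exists2 h' : {poly R}, (size h' < size h)%N &
      exists k, h = h' + k * p%:P.
  move=> h0 [c ec]; exists (h - lead_coef h *: 'X^((size h).-1)).
    case: (ltngtP (size h) 1) => [|h1|/eqP/size_poly1P[b b0 ->]].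
    - by rewrite ltnS leqn0 size_poly_eq0 (negPf h0).
    - rewrite -(prednK (ltnW h1)) ltnS; apply/leq_sizeP => j.
      rewrite coefB coefZ coefXn leq_eqVlt => /orP[/eqP<-|lj].
        by rewrite eqxx mulr1 subrr.
      rewrite gtn_eqF // mulr0 subr0 nth_default //.
      by rewrite -(prednK (ltnW h1)).
    - by rewrite lead_coefC size_polyC b0 /= expr0 -mul_polyC mulr1 subrr size_poly0.
  exists (c *: 'X^((size h).-1)); rewrite ec -!mul_polyC polyCM; ring.
have absorb (h h' k : {poly R}) : h = h' + k * p%:P -> divides p%:P h' -> divides p%:P h.
  by move=> -> [l ->]; exists (l + k); rewrite mulrDl.
have /pP[/(strip _ f0)|/(strip _ g0)] : divides p (lead_coef f * lead_coef g).
- by rewrite -lead_coefM; have [k ->] := pfg; exists (lead_coef k);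
    rewrite lead_coefM lead_coefC.
- case=> f' lf [k ef]; have [l el] := pfg.
  have [||pf'|pg] := IHm f' g; last by right.
  + by rewrite -ltnS; apply: leq_trans lem; rewrite ltnS ltn_add2r.
  + by exists (l - k * g); rewrite mulrBl -el ef; ring.
  + by left; apply: absorb ef pf'.
- case=> g' lg [k eg]; have [l el] := pfg.
  have [||pf|pg'] := IHm f g'; last by right; apply: absorb eg pg'.
  + by rewrite -ltnS; apply: leq_trans lem; rewrite ltnS ltn_add2l.
  + by exists (l - k * f); rewrite mulrBl -el eg; ring.
  + by left.
Qed.

(** The primes of c are cancelled one by one from c g = q f: none of them divides the primitive f,
    so each divides q. *)
Lemma primitive_divides c f g : c != 0 -> primitive f ->
  divides f (c%:P * g) -> divides f g.
Proof.
move=> c0 fP; have [s [u [uU sP ->]]] := factR c0.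
elim: s sP => [_|p s IHs sP].
  rewrite big_nil mulr1 => -[q e]; exists ((u^-1)%:P * q).
  by rewrite -mulrA -e mulrA -polyCM mulVr // mul1r.
have pP := sP p (mem_head _ _); have [p0 _ _] := prime_elt_polyC pP.
rewrite big_cons => -[q e]; apply: IHs => [r rs|].
  by apply: sP; rewrite inE rs orbT.
have [_ _ /(_ q f)[]] := prime_elt_polyC pP.
- by rewrite -e; exists ((u * \prod_(j <- s) j)%:P * g); rewrite !polyCM; ring.
- case=> q' e'; exists q'; apply: (mulIf p0).
  rewrite !polyCM e' in e *.
  by transitivity (q' * p%:P * f); [rewrite -e|]; ring.
- by move=> /(fP p pP).
Qed.

(** Each prime of c divides d or q and is divided out there; scaling by a nonzero constant preserves
    sizes. *)
Lemma clear_constant c f d q : c != 0 -> c%:P * f = d * q -> f != 0 ->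
  exists d' q', [/\ f = d' * q', size d' = size d & size q' = size q].
Proof.
move=> c0 + f0; have [s [u [uU sP ->]]] := factR c0.
elim: s sP d q => [_|p s IHs sP] d q.
  rewrite big_nil mulr1 => e; exists ((u^-1)%:P * d), q; split => //.
    by rewrite -mulrA -e mulrA -polyCM mulVr // mul1r.
  by rewrite size_Cmul // invr_eq0; apply: contraTneq uU => ->; rewrite unitr0.
have pP := sP p (mem_head _ _); have [p0 _ /(_ d q)ppP] := prime_elt_polyC pP.
have IH := IHs (fun r rs => sP r (mem_behead (s := p :: s) rs)).
have p0' : p != 0 by rewrite -polyC_eq0.
rewrite big_cons => e; case: ppP.
- by rewrite -e; exists ((u * \prod_(j <- s) j)%:P * f); rewrite !polyCM; ring.
- case=> d1 ed; have [|d' [q' [ef sd sq]]] := IH d1 q.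
    apply: (mulIf p0); rewrite !polyCM ed in e *.
    by transitivity (d1 * p%:P * q); [rewrite -e|]; ring.
  by exists d', q'; split; rewrite // sd ed mulrC size_Cmul.
- case=> q1 eq; have [|d' [q' [ef sd sq]]] := IH d q1.
    apply: (mulIf p0); rewrite !polyCM eq in e *.
    by transitivity (d * (q1 * p%:P)); [rewrite -e|]; ring.
  by exists d', q'; split; rewrite // sq eq mulrC size_Cmul.
Qed.

(** Suppose f divides g h. A nonzero d of least size in the ideal (f, g) divides, by
    pseudo-division, nonzero constant multiples of f and of g. By irreducibility, either the
    cofactor of d in c f is constant, and f divides a constant multiple of g, or d is constant, and
    f divides d h. [primitive_divides] removes the constants. *)
Lemma primitive_irreducible_prime f : primitive f -> (1 < size f)%N ->
    (forall a b, f = a * b -> (size a <= 1)%N \/ (size b <= 1)%N) ->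
  prime_elt f.
Proof.
move=> fP f1 irr; have f0 : f != 0 by rewrite -size_poly_gt0 (ltn_trans _ f1).
split=> //; first by rewrite poly_unitE gtn_eqF.
move=> g h [k efk].
pose ideal (d : {poly R}) := exists a b, d = a * f + b * g.
have [d [d0 [a [b ed]] dmin]] : exists d, [/\ d != 0, ideal d &
    forall r, ideal r -> (size r < size d)%N -> r = 0].
  suff minI m d : d != 0 -> ideal d -> (size d < m)%N -> exists d, [/\ d != 0, ideal d &
      forall r, ideal r -> (size r < size d)%N -> r = 0].
    by apply: (minI (size f).+1 f) => //; exists 1, 0; ring.
  elim: m d => // m IHm d d0 dI lem.
  have [[r [rI rd r0]]|H] :=
    EM (exists r, [/\ ideal r, (size r < size d)%N & r != 0]).
    by apply: (IHm r) => //; apply: leq_trans rd _; rewrite -ltnS.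
  exists d; split=> [//|//|r rI rd]; apply/eqP/negP => /negP r0.
  by apply: H; exists r.
have divd r : ideal r -> exists c q, c != 0 /\ c%:P * r = q * d.
  move=> [a' [b' er]].
  have e := Pdiv.Idomain.divp_eq r d.
  have lc0 : lead_coef d != 0 by rewrite lead_coef_eq0.
  exists (lead_coef d ^+ scalp r d), (r %/ d); split; first exact: expf_neq0.
  rewrite mul_polyC e [r %% d]dmin ?addr0 ?ltn_modp //.
  exists ((lead_coef d ^+ scalp r d)%:P * a' - (r %/ d) * a).
  exists ((lead_coef d ^+ scalp r d)%:P * b' - (r %/ d) * b).
  apply: (addrI (r %/ d * d)); rewrite -e -mul_polyC er ed; ring.
have [c [q [c0 eq]]] : exists c q, c != 0 /\ c%:P * f = q * d.
  by apply: divd; exists 1, 0; ring.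
have [c' [q' [c'0 eq']]] : exists c q, c != 0 /\ c%:P * g = q * d.
  by apply: divd; exists 0, 1; ring.
have [q0 [d1 [ef sq sd]]] := clear_constant c0 eq f0.
case: (irr _ _ ef).
- rewrite sq => /size1_polyC eq0; left.
  have q00 : q != 0 by apply: contraTneq f0 => q0E; rewrite q0E mul0r in eq;
    move/eqP: eq; rewrite mulf_eq0 polyC_eq0 (negPf c0) /= negbK.
  have c1 : c' * q`_0 != 0.
    by rewrite mulf_neq0 //; apply: contraNneq q00 => e; rewrite eq0 e.
  apply: (primitive_divides c1 fP); exists (q' * c%:P).
  rewrite polyCM -eq0 mulrAC eq' -mulrA [d * q]mulrC -eq; ring.
- rewrite sd => /size1_polyC eq0; right.
  have c1 : d`_0 != 0 by apply: contraNneq d0 => e; rewrite eq0 e.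
  apply: (primitive_divides c1 fP); exists (a * h + b * k).
  rewrite -eq0 ed mulrDl -[b * g * h]mulrA efk; ring.
Qed.

(** Induction on the number of primes in a factorization of the leading coefficient: every prime
    constant extracted from f uses up one of them. *)
Lemma primitive_part f : f != 0 -> exists s f0,
  [/\ forall p : R, p \in s -> prime_elt p, primitive f0
    & f = (\prod_(p <- s) p)%:P * f0].
Proof.
move=> f0; have lf0 : lead_coef f != 0 by rewrite lead_coef_eq0.
have [t [u [uU tP]]] := factR lf0.
have [m] := ubnP (size t); elim: m t u uU f f0 tP {lf0} => // m IHm t u uU f f0 tP lem elf.
have [fP|/existsNP[p /not_implyP[pP /contrapT[g ef]]]] := EM (primitive f).
  by exists [::], f; split; rewrite // big_nil mul1r.
have g0 : g != 0 by apply: contraNneq f0 => g0; rewrite ef g0 mul0r.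
have := pP; case=> p0 pU pprime.
have elg : lead_coef f = lead_coef g * p by rewrite ef lead_coefM lead_coefC.
have [q qt [c eq]] : exists2 q, q \in t & divides p q.
  apply: prime_divides_prod => //; have [] := pprime u (\prod_(q <- t) q).
  - by exists (lead_coef g); rewrite -elf.
  - by move/(divides_unit uU); rewrite (negPf pU).
  - by [].
have [w wU ew] := prime_divides_primeP pP (tP q qt) (ex_intro _ c eq).
have [||||s [f1 [sP f1P eg]]] := IHm (rem q t) (u * w) _ g g0.
- by rewrite unitrM uU.
- by move=> r /mem_rem/tP.
- rewrite size_rem //; case: (t) qt lem => //.
- apply: (mulIf p0); rewrite -elg elf (perm_big _ (perm_to_rem qt)) big_cons {1}ew.
  by rewrite !mulrA mulrAC.
exists (p :: s), f1; split=> //.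
  by move=> r; rewrite inE => /orP[/eqP->|/sP].
by rewrite big_cons polyCM ef eg; ring.
Qed.

(** Induction on the size. A primitive constant is a unit; a larger f either splits into two
    nonconstant factors, again primitive, or is prime by [primitive_irreducible_prime]. *)
Lemma primitive_factors f : f != 0 -> primitive f -> factors_into_primes f.
Proof.
have [m] := ubnP (size f); elim: m f => // m IHm f lem f0 fP.
have [f1|f1] := leqP (size f) 1.
  exists [::], f; split=> //; last by rewrite big_nil mulr1.
  have ec := size1_polyC f1; have c0 : f`_0 != 0.
    by apply: contraNneq f0 => e; rewrite ec e.
  have [[|p t] [u [uU tP e]]] := factR c0.
    by rewrite poly_unitE ec size_polyC c0 coefC e big_nil mulr1 uU.
  case: (fP p (tP p (mem_head _ _))); rewrite ec e big_cons.
  by exists (u * \prod_(j <- t) j)%:P; rewrite -polyCM; congr polyC; ring.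
have [[a [b [ef a1 b1]]]|H] :=
  EM (exists a b, [/\ f = a * b, (1 < size a)%N & (1 < size b)%N]); last first.
  exists [:: f], 1; split; rewrite ?unitr1 ?big_seq1 ?mul1r // => p.
  rewrite inE => /eqP->; apply: primitive_irreducible_prime => // a b ef.
  have [|a1] := leqP (size a) 1; first by left.
  have [|b1] := leqP (size b) 1; first by right.
  by case: H; exists a, b.
have a0 : a != 0 by rewrite -size_poly_gt0 ltnW.
have b0 : b != 0 by rewrite -size_poly_gt0 ltnW.
have sf : size f = (size a + size b).-1 by rewrite ef size_mul.
have [|||s [u [uU sP ea]]] := IHm a => //.
- rewrite -ltnS; apply: leq_trans lem; rewrite sf ltnS.
  by case: (size b) b1 => [|[|k]] // _; rewrite !addnS /= ltnS leq_addr.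
- by move=> p pP pa; apply: (fP p pP); rewrite ef; apply: divides_mulr.
have [|||t [v [vU tP eb]]] := IHm b => //.
- rewrite -ltnS; apply: leq_trans lem; rewrite sf ltnS.
  by case: (size a) a1 => [|[|k]] // _; rewrite !addSn /= ltnS leq_addl.
- by move=> p pP pa; apply: (fP p pP); rewrite ef; apply: divides_mull.
exists (s ++ t), (u * v); split; first by rewrite unitrM uU.
  by move=> p; rewrite mem_cat => /orP[/sP|/tP].
by rewrite ef ea eb big_cat /=; ring.
Qed.

Lemma poly_factorial : factorial_ring {poly R}.
Proof.
move=> f f0; have [s [f1 [sP f1P ef]]] := primitive_part f0.
have f10 : f1 != 0 by apply: contraNneq f0 => e; rewrite ef e mulr0.
have [t [u [uU tP ef1]]] := primitive_factors f10 f1P.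
exists ([seq p%:P | p <- s] ++ t), u; split=> //.
  move=> p; rewrite mem_cat => /orP[/mapP[q /sP qP ->]|/tP//].
  exact: prime_elt_polyC.
by rewrite big_cat /= big_map ef ef1 rmorph_prod /=; ring.
Qed.

End FactorialPoly.

Lemma factorial_iso (A B : idomainType) (f : {rmorphism A -> B})
    (g : {rmorphism B -> A}) :
  cancel f g -> cancel g f -> factorial_ring A -> factorial_ring B.
Proof.
move=> fK gK fA x x0; have gx0 : g x != 0.
  by apply: contraNneq x0 => e; rewrite -(gK x) e rmorph0.
have [s [u [uU sP e]]] := fA _ gx0.
exists [seq f p | p <- s], (f u); split; first exact: rmorph_unit.
  move=> _ /mapP[p /sP[p0 pU pP] ->]; split.
  - by apply: contraNneq p0 => e0; rewrite -(fK p) e0 rmorph0.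
  - by apply: contraNN pU => /(rmorph_unit g); rewrite fK.
  - move=> a b [c ec]; have [|[d ed]|[d ed]] := pP (g a) (g b).
    + by exists (g c); rewrite -rmorphM ec rmorphM fK.
    + by left; exists (f d); rewrite -(gK a) ed rmorphM.
    + by right; exists (f d); rewrite -(gK b) ed rmorphM.
by rewrite big_map -rmorph_prod -rmorphM -e gK.
Qed.

(** * Factoriality of K[x_1, ..., x_n] by induction on n *)

Section MpolyFactorial.
Variables (K : fieldType).

Let muniX n (m : 'X_{1..n.+1}) : muni 'X_[K, m] =
  'X_[[multinom m (widen_ord (leqnSn n) i) | i < n]] *: 'X^(m ord_max).
Proof. by rewrite muniE msuppX big_seq1 mcoeffX eqxx scale1r. Qed.

(** The inverse of [muni]: it substitutes the last variable for the indeterminate. *)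
Let multi n : {rmorphism {poly {mpoly K[n]}} -> {mpoly K[n.+1]}} :=
  horner_eval ('X_ord_max : {mpoly K[n.+1]}) \o map_poly (@mwiden n K).

Let multiE n (p : {poly {mpoly K[n]}}) : multi n p = (map_poly (@mwiden n K) p).['X_ord_max].
Proof. by []. Qed.

Let muniU n : muni ('X_ord_max : {mpoly K[n.+1]}) = 'X.
Proof.
rewrite muniX mnm1E eqxx expr1 -[RHS]scale1r -mpolyX0; congr ('X_[_] *: _).
by apply/mnmP => i; rewrite mnmE mnm1E mnm0E -val_eqE /= gtn_eqF.
Qed.


Let muni_mwiden n (c : {mpoly K[n]}) : muni (mwiden c) = c%:P.
Proof.
rewrite [in LHS](mpolyE c) [in RHS](mpolyE c).
rewrite (raddf_sum (@mwiden n K : {additive _ -> _})).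
rewrite (raddf_sum (@muni n K : {additive _ -> _})) raddf_sum /=.
apply: eq_bigr => m _.
rewrite mwidenZ muniZ mwidenX muniX mnmwiden_ordmax expr0 alg_polyC -mul_polyC.
rewrite -polyCM mul_mpolyC; congr (_ *: 'X_[_])%:P.
by apply/mnmP => i; rewrite mnmE mnmwiden_widen.
Qed.

Lemma mpoly_factorial n : factorial_ring {mpoly K[n]}.
Proof.
elim: n => [|n IHn].
  move=> x x0; exists [::], x; split=> //; last by rewrite big_nil mulr1.
  have ex := nvar0_mpolyC x; apply/andP; split; first exact/eqP.
  by rewrite unitfE; apply: contraNneq x0 => e; rewrite ex e mpolyC0.
have multiK : cancel (multi n) (@muni n K).
    elim/poly_ind => [|p c IHp]; first by rewrite multiE rmorph0 horner0 muni0.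
    rewrite multiE rmorphD rmorphM /= map_polyX map_polyC /= hornerMXaddC -multiE.
    by rewrite muniD muniM IHp muniU muni_mwiden.
  have muniK : cancel (@muni n K) (multi n).
    move=> p; rewrite [in LHS](mpolyE p) [in RHS](mpolyE p).
    rewrite (raddf_sum (@muni n K : {additive _ -> _})) raddf_sum.
    apply: eq_bigr => m _; transitivity (multi n ((p@_m)%:MP *: muni 'X_[m])).
      by congr (multi n _); exact: muniZ.
    rewrite muniX -!mul_polyC multiE !rmorphM /= !map_polyC map_polyXn /=.
    rewrite !hornerM !hornerC hornerXn mwidenC mul_mpolyC; congr (_ *: _).
    rewrite mwidenX mpolyXn -mpolyXD; congr 'X_[_]; apply/mnmP => i.
    rewrite mnmDE mulmnE mnm1E; case: (unliftP ord_max i) => [j|] ->.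
      rewrite (_ : lift _ _ = widen_ord (leqnSn n) j); last exact/val_inj/lift_max.
      by rewrite mnmwiden_widen mnmE -val_eqE /= gtn_eqF ?addn0.
    by rewrite mnmwiden_ordmax eqxx mul1n.
apply: (factorial_iso (f := multi n) (g := @muni n K) multiK muniK).
exact: poly_factorial IHn.
Qed.
End MpolyFactorial.

(** * Degree outside a face and powers of the ideals P_G *)

Section OutsideDegree.
Variables (K : fieldType) (n : nat).
Implicit Types (F G : {set 'I_n}) (m : 'X_{1..n}) (f g a s : {mpoly K[n]}).
Implicit Types (P J : pred 'X_{1..n}).

Definition outdeg G m : nat := (\sum_(i | i \notin G) m i)%N.

Lemma outdegD G m1 m2 : outdeg G (m1 + m2)%MM = (outdeg G m1 + outdeg G m2)%N.
Proof. by rewrite -big_split; apply: eq_bigr => i _; rewrite mnmDE. Qed.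

Lemma outdeg1 G i : outdeg G U_(i)%MM = (i \notin G).
Proof.
rewrite /outdeg; have [iG|iG] := boolP (i \in G).
  rewrite big1 // => j jG; rewrite mnm1E; case: eqP => // ij.
  by rewrite -ij iG in jG.
rewrite (bigD1 i) //= mnm1E eqxx big1 // => j /andP[_ ji].
by rewrite mnm1E eq_sym (negPf ji).
Qed.

Lemma leq_odeg F G m : F \subset G -> (outdeg G m <= outdeg F m)%N.
Proof.
move=> sFG; rewrite /outdeg big_mkcond [leqRHS]big_mkcond; apply: leq_sum => i _.
by have [iF|_] := boolP (i \in F); [rewrite (subsetP sFG)|case: ifP].
Qed.

Lemma outdeg_eq0 G m : (outdeg G m == 0%N) = [forall (i | i \notin G), m i == 0%N].
Proof.
by rewrite /outdeg sum_nat_eq0.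
Qed.

Lemma outdeg_gt0P G m : reflect (exists2 i, i \notin G & (0 < m i)%N) (0 < outdeg G m)%N.
Proof.
rewrite lt0n outdeg_eq0; apply: (iffP forall_inPn) => -[i].
  by rewrite -lt0n; exists i.
by move=> iG mi; exists i => //; rewrite -lt0n.
Qed.

Definition mcut P f : {mpoly K[n]} := \sum_(m <- msupp f | P m) f@_m *: 'X_[m].

Lemma mcoeff_mcut P f m : (mcut P f)@_m = if P m then f@_m else 0.
Proof.
rewrite /mcut raddf_sum /=.
have [mf|mf] := boolP (m \in msupp f); last first.
  rewrite memN_msupp_eq0 // if_same big_seq_cond big1 // => m' /andP[m'f _].
  rewrite mcoeffZ mcoeffX; case: eqP => [e|]; last by rewrite mulr0.
  by rewrite -e m'f in mf.
rewrite big_mkcond (bigD1_seq m) ?msupp_uniq //= [X in _ + X]big1 ?addr0.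
  by case: ifP => // _; rewrite mcoeffZ mcoeffX eqxx mulr1.
move=> m' m'm; case: ifP => // _; rewrite mcoeffZ mcoeffX (negPf m'm) mulr0 //.
Qed.

Lemma mcoeffM_eq0 f g m :
    (forall m1 m2, m = (m1 + m2)%MM -> f@_m1 = 0 \/ g@_m2 = 0) ->
  (f * g)@_m = 0.
Proof.
move=> H; rewrite mcoeffM big1 // => -[m1 m2] /= /eqP /H[] ->.
  by rewrite mul0r.
by rewrite mulr0.
Qed.

(* Homogeneous part for the degree outside G; hpart G 0 f stands for the image of
   f in S/P_G, the polynomial ring in the variables of G. *)
Definition hpart G k f := mcut (fun m => outdeg G m == k) f.

(* Membership in the k-th power of P_G. *)
Definition Ppow G k f := forall m, (outdeg G m < k)%N -> f@_m = 0.

Lemma Ppow0 G f : Ppow G 0 f. Proof. by []. Qed.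

Lemma Ppow_leq G j k f : (j <= k)%N -> Ppow G k f -> Ppow G j f.
Proof. by move=> jk fk m mj; apply: fk; apply: leq_trans jk. Qed.

Lemma PpowS F G k f : F \subset G -> Ppow G k f -> Ppow F k f.
Proof. by move=> sFG fk m mj; apply: fk; apply: leq_ltn_trans mj; apply: leq_odeg. Qed.

Lemma PpowD G k f g : Ppow G k f -> Ppow G k g -> Ppow G k (f + g).
Proof. by move=> fk gk m mk; rewrite mcoeffD fk // gk // addr0. Qed.

Lemma PpowN G k f : Ppow G k f -> Ppow G k (- f).
Proof. by move=> fk m mk; rewrite mcoeffN fk // oppr0. Qed.

Lemma PpowB G k f g : Ppow G k f -> Ppow G k g -> Ppow G k (f - g).
Proof. by move=> fk gk; apply: PpowD => //; apply: PpowN. Qed.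

Lemma Ppow_sum (I : Type) (r : seq I) (Q : pred I) G k (h : I -> {mpoly K[n]}) :
  (forall i, Q i -> Ppow G k (h i)) -> Ppow G k (\sum_(i <- r | Q i) h i).
Proof.
move=> H m mk; rewrite raddf_sum big1 // => i Qi; exact: H.
Qed.

Lemma PpowM G j k f g : Ppow G j f -> Ppow G k g -> Ppow G (j + k) (f * g).
Proof.
move=> fj gk m mjk; apply: mcoeffM_eq0 => m1 m2 em.
have [lt1|le1] := ltnP (outdeg G m1) j; first by left; apply: fj.
right; apply: gk; rewrite em outdegD in mjk.
by rewrite -(ltn_add2l (outdeg G m1)); apply: leq_trans mjk _; rewrite leq_add2r.
Qed.

Lemma PpowMl G k f g : Ppow G k g -> Ppow G k (f * g).
Proof. by move/(PpowM (@Ppow0 G f)). Qed.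

Lemma PpowMr G k f g : Ppow G k f -> Ppow G k (f * g).
Proof. by rewrite mulrC; apply: PpowMl. Qed.

Lemma PpowX G m : Ppow G (outdeg G m) 'X_[K, m].
Proof. by move=> m' lt; rewrite mcoeffX; case: eqP lt => // ->; rewrite ltnn. Qed.

Lemma PpowXU G i : i \notin G -> Ppow G 1 ('X_i : {mpoly K[n]}).
Proof. by move=> iG; have := @PpowX G U_(i)%MM; rewrite outdeg1 iG. Qed.

Lemma PpowE G k f : f = \sum_(m <- msupp f | (k <= outdeg G m)%N) f@_m *: 'X_[m] <->
  Ppow G k f.
Proof.
split=> [->|fk].
  apply: Ppow_sum => m km; rewrite -mul_mpolyC; apply: PpowMl.
  by apply: (Ppow_leq km); apply: PpowX.
apply/mpolyP => m; rewrite -/(mcut (fun m => k <= outdeg G m)%N f) mcoeff_mcut.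
by case: leqP => // /fk.
Qed.

Lemma mcoeff_hpart G k f m : (hpart G k f)@_m = if outdeg G m == k then f@_m else 0.
Proof. exact: mcoeff_mcut. Qed.

Lemma hpartB G k f g : hpart G k (f - g) = hpart G k f - hpart G k g.
Proof.
apply/mpolyP => m; rewrite mcoeffB !mcoeff_hpart mcoeffB.
by case: ifP => //; rewrite subr0.
Qed.

Lemma hpart_id G k f : hpart G k (hpart G k f) = hpart G k f.
Proof. by apply/mpolyP => m; rewrite !mcoeff_hpart; case: eqP. Qed.

Lemma hpart_Ppow G k f : Ppow G k (hpart G k f).
Proof. by move=> m mk; rewrite mcoeff_hpart ltn_eqF. Qed.

Lemma PpowSn G k f : Ppow G k f -> hpart G k f = 0 -> Ppow G k.+1 f.
Proof.
move=> fk f0 m; rewrite ltnS leq_eqVlt => /orP[/eqP e|/fk //].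
by have := mcoeff_hpart G k f m; rewrite f0 mcoeff0 e eqxx.
Qed.

Lemma hpart_eq0 G k f : Ppow G k.+1 f -> hpart G k f = 0.
Proof.
move=> fk; apply/mpolyP => m; rewrite mcoeff_hpart mcoeff0.
by case: eqP => // e; apply: fk; rewrite e.
Qed.

Lemma hpart0_eq0 G f : hpart G 0 f = 0 <-> Ppow G 1 f.
Proof. by split=> [f0|]; [apply: (PpowSn (@Ppow0 G f)) | apply: hpart_eq0]. Qed.

Lemma sub_hpart0_Ppow G f : Ppow G 1 (f - hpart G 0 f).
Proof. by apply: PpowSn => //; rewrite hpartB hpart_id subrr. Qed.

Lemma hpart_mul0 G k g a : hpart G k (hpart G 0 g * a) = hpart G 0 g * hpart G k a.
Proof.
apply/mpolyP => m; rewrite mcoeff_hpart.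
have [e|e] := eqVneq (outdeg G m) k; last first.
  rewrite mcoeffM_eq0 // => m1 m2 em; rewrite !mcoeff_hpart.
  have [m10|_] := eqVneq (outdeg G m1) 0%N; last by left.
  by right; case: eqP => // m2k; move: e; rewrite em outdegD m10 m2k eqxx.
rewrite !mcoeffM; apply: eq_bigr => -[m1 m2] /= /eqP em; rewrite !mcoeff_hpart.
have [m10|] := eqVneq (outdeg G m1) 0%N; last by rewrite !mul0r.
by have := congr1 (outdeg G) em; rewrite outdegD m10 add0n e => <-; rewrite eqxx.
Qed.

(** The difference of g and its part of outside degree 0 lies in P_G, so it contributes to g a only
    in outside degree above k. *)
Lemma hpartM G k g a : Ppow G k a -> hpart G k (g * a) = hpart G 0 g * hpart G k a.
Proof.
move=> ak; rewrite -hpart_mul0; apply/eqP; rewrite -subr_eq0 -hpartB -mulrBl.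
by apply/eqP/hpart_eq0; apply: (@PpowM _ 1%N) => //; apply: sub_hpart0_Ppow.
Qed.

Lemma hpart0M G g a : hpart G 0 (g * a) = hpart G 0 g * hpart G 0 a.
Proof. exact: hpartM. Qed.

(** [J] is the set of exponents of a monomial ideal that is insensitive to the variables of F; s,
    being outside P_F, is a nonzerodivisor modulo it. Drop from d the monomials in [J]. If something
    remains, its part of lowest outside degree times that of s has a leading monomial outside [J],
    which then occurs in s d. *)
Lemma monomial_primary F J s d : ~ Ppow F 1 s ->
    (forall m m', J m -> J (m + m')%MM) ->
    (forall m m', outdeg F m' = 0%N -> J (m + m')%MM -> J m) ->
    (forall m, ~~ J m -> (s * d)@_m = 0) ->
  forall m, ~~ J m -> d@_m = 0.
Proof.
move=> sF Jup Jdown sdJ m Jm; apply/eqP/negP => /negP dm.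
pose e := mcut (predC J) d.
have [k [eP ek]] : exists k, Ppow F k e /\ hpart F k e != 0.
  have ex : exists k, has (fun m => outdeg F m == k) (msupp e).
    exists (outdeg F m); apply/hasP; exists m => //.
    by rewrite mcoeff_msupp mcoeff_mcut /= Jm.
  have [k /hasP[m' m'e /eqP km'] kmin] := ex_minnP ex.
  exists k; split=> [m1 m1k|].
    apply/eqP; rewrite mcoeff_eq0; apply: contraL m1k => m1e; rewrite -leqNgt.
    by apply: kmin; apply/hasP; exists m1.
  apply: contraTneq m'e => e0; rewrite mcoeff_msupp negbK.
  by have := mcoeff_hpart F k e m'; rewrite e0 mcoeff0 km' eqxx => <-.
have s0 : hpart F 0 s != 0 by apply/eqP => /hpart0_eq0.
pose M := mlead (hpart F 0 s * hpart F k e).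
have : (hpart F 0 s * hpart F k e)@_M != 0.
  by rewrite mleadc_eq0 mulf_neq0.
rewrite -hpartM // mcoeff_hpart; case: ifP; last by rewrite eqxx.
(* The leading monomial of the part of s involves only variables of F, so by [Jdown] it cannot move
   the other leading monomial into [J]. *)
move=> _ /eqP[]; have JM : ~~ J M.
  rewrite /M mleadM // addmC; have := mlead_supp ek; have := mlead_supp s0.
  rewrite !mcoeff_msupp !mcoeff_hpart; case: ifP => [/eqP l0 _|_]; last by rewrite eqxx.
  case: ifP => _; last by rewrite eqxx.
  rewrite mcoeff_mcut /=; case: ifP => [|_]; last by rewrite eqxx.
  by move=> + _; apply: contraNN; apply: Jdown.
(* The products s e and s d agree at [M]: the monomials of d - e lie in [J], and so do their
   multiples. *)
rewrite -[RHS](sdJ M JM); apply/eqP; rewrite -subr_eq0 -mcoeffB -mulrBr.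
apply/eqP/mcoeffM_eq0 => m1 m2 eM; right.
rewrite mcoeffB mcoeff_mcut /=; case: ifP => [_|]; first by rewrite subrr.
by move/negbT; rewrite negbK => /(Jup _ m1); rewrite addmC -eM (negPf JM).
Qed.

(** The powers of P_G are P_G-primary. *)
Lemma Ppow_primary G k s d : ~ Ppow G 1 s -> Ppow G k (s * d) -> Ppow G k d.
Proof.
move=> sG sdk m mk; apply: (@monomial_primary G (fun m => k <= outdeg G m)%N s d) => //.
- by move=> m1 m2 km; rewrite outdegD (leq_trans km) ?leq_addr.
- by move=> m1 m2 m20; rewrite outdegD m20 addn0.
- by move=> m1; rewrite -ltnNge; apply: sdk.
- by rewrite -ltnNge.
Qed.

(** Compare the parts of outside degree k: the relation becomes one in the associated graded ring of
    P_G, where the first hypothesis gives the quotient. *)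
Lemma regular_step G k f g a h :
    (forall a, divides (hpart G 0 f) (hpart G 0 g * a) -> divides (hpart G 0 f) a) ->
    hpart G 0 f != 0 -> Ppow G k a -> Ppow G k h -> Ppow G k.+1 (g * a - f * h) ->
  exists c, [/\ Ppow G k c, Ppow G k.+1 (a - f * c) & Ppow G k.+1 (h - g * c)].
Proof.
move=> cop f0 ak hk /hpart_eq0/eqP; rewrite hpartB !hpartM // subr_eq0 => /eqP e.
have [|c ec] := cop (hpart G k a); first by exists (hpart G k h); rewrite e mulrC.
have ea : hpart G k a = hpart G 0 f * hpart G k c.
  by rewrite -hpart_id ec mulrC hpart_mul0.
have eh : hpart G k h = hpart G 0 g * hpart G k c.
  by apply: (mulfI f0); rewrite -e ea; ring.
have cP := @hpart_Ppow G k c.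
exists (hpart G k c); split=> //; apply: PpowSn.
- by apply: PpowB => //; apply: PpowMl.
- by rewrite hpartB hpartM // hpart_id ea subrr.
- by apply: PpowB => //; apply: PpowMl.
- by rewrite hpartB hpartM // hpart_id eh subrr.
Qed.

(** Two steps, in outside degrees 0 and 1. Replacing a by a - f c and h by h - g c leaves g a - f h
    unchanged. *)
Lemma regular_mod_square G f g a h :
    (forall a, divides (hpart G 0 f) (hpart G 0 g * a) -> divides (hpart G 0 f) a) ->
    hpart G 0 f != 0 -> Ppow G 2 (g * a - f * h) ->
  exists c, Ppow G 2 (a - f * c).
Proof.
move=> cop f0 gafh.
have [||c [_ ac hc]] := regular_step cop f0 _ _ (Ppow_leq (leqnSn 1) gafh) => //.
have [|c' [_ ac' _]] := regular_step cop f0 ac hc.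
  by rewrite (_ : _ - _ = g * a - f * h) //; ring.
by exists (c + c'); rewrite mulrDr opprD addrA.
Qed.

Lemma ideal_gen_sum (G : {mpoly K[n]} -> Prop) (I : eqType) (r : seq I)
    (Q : pred I) (h : I -> {mpoly K[n]}) :
  (forall i, Q i -> h i \in ideal_gen G) -> \sum_(i <- r | Q i) h i \in ideal_gen G.
Proof.
move=> H; apply: (big_ind (fun x => x \in ideal_gen G)) => //.
  exact: ideal_gen0.
by move=> x y xG yG; rewrite -[x]mul1r; apply: ideal_genMD.
Qed.

Lemma ideal_gen_Ml (G : {mpoly K[n]} -> Prop) a f :
  f \in ideal_gen G -> a * f \in ideal_gen G.
Proof. by move=> fG; rewrite -[_ * _]addr0 ideal_genMD // ideal_gen0. Qed.

Lemma face_idealP G f : f \in @face_ideal K n G <-> Ppow G 1 f.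
Proof.
split=> [/asboolP[s [sG ->]]|].
  rewrite big_seq; apply: Ppow_sum => p /sG[i iG ->].
  by apply: PpowMl; apply: PpowXU.
move/PpowE => ->; apply: ideal_gen_sum => m /outdeg_gt0P[i iG mi].
rewrite -mul_mpolyC; apply: ideal_gen_Ml.
rewrite -(@submK _ U_(i) m) ?lep1mP -?lt0n // mpolyXD; apply: ideal_gen_Ml.
by apply: ideal_gen_sub; exists i.
Qed.

Lemma face_ideal_squareP G f :
  f \in ideal_mul (@face_ideal K n G) (@face_ideal K n G) <-> Ppow G 2 f.
Proof.
split=> [/asboolP[s [sG ->]]|].
  rewrite big_seq; apply: Ppow_sum => p /sG[a [b [/face_idealP aG /face_idealP bG ->]]].
  by apply: PpowMl; apply: (PpowM aG bG).
move/PpowE => ->; apply: ideal_gen_sum => m m2.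
rewrite -mul_mpolyC; apply: ideal_gen_Ml.
have /outdeg_gt0P[i iG mi] : (0 < outdeg G m)%N by apply: ltnW.
have em := @submK _ U_(i) m; rewrite lep1mP -lt0n in em.
rewrite -em // in m2 *; rewrite mpolyXD; apply: ideal_gen_sub.
exists 'X_[m - U_(i)], 'X_i; split=> //; apply/face_idealP; last exact: PpowXU.
apply: Ppow_leq (@PpowX _ _).
by rewrite outdegD outdeg1 iG addn1 ltnS in m2.
Qed.

Lemma symbolic_squareP (D : simplicial_complex n) f :
  f \in symbolic_square K D <-> forall G, G \in facets D -> Ppow G 2 f.
Proof.
split=> [/forall_inP H G GD|H]; first exact/face_ideal_squareP/H.
by apply/forall_inP => G GD; apply/face_ideal_squareP/H.
Qed.

End OutsideDegree.

(** * Connectivity of facets and gluing *)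

Section StrongConnectivity.
Variables (n : nat) (D : simplicial_complex n).
Implicit Types (F G H : {set 'I_n}) (a : 'X_{1..n}).

Lemma facets_faces G : G \in facets D -> G \in faces D.
Proof. by rewrite inE => /maxsetp. Qed.

Lemma facet_max G F : G \in facets D -> F \in faces D -> G \subset F -> F = G.
Proof. by rewrite inE => /maxsetP[_ H]; apply: H. Qed.

Lemma face_in_facet F : F \in faces D -> exists2 G, G \in facets D & F \subset G.
Proof.
move=> FD; have [G Gm FG] := maxset_exists (P := mem (faces D)) FD.
by exists G; rewrite ?inE.
Qed.

Lemma in_linkP F H : reflect (H :|: F \in faces D /\ H :&: F = set0) (H \in link D F).
Proof.
rewrite inE; apply: (iffP and3P) => [[_ HF /eqP]|[HF HF0]] //; split=> //.
  by apply: faces_sub HF _; apply: subsetUl.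
exact/eqP.
Qed.

Lemma complex_dim_linkP F : 1 <= complex_dim (link D F) <->
  exists2 H, H \in link D F & (2 <= #|H|)%N.
Proof.
rewrite /complex_dim lerBrDr; split=> [le2|[H HF H2]].
  apply: contrapT => noH; have : (\max_(H in link D F) #|H| <= 1)%N.
    apply/bigmax_leqP => G GF; rewrite leqNgt; apply/negP => G2.
    by apply: noH; exists G.
  by move: le2; rewrite (_ : 1 + 1 = 2%N :> int) // lez_nat; case: (\max_(_ in _) _)%N => [|[]].
rewrite (_ : 1 + 1 = 2%N :> int) // lez_nat.
by apply: leq_trans H2 _; apply: leq_bigmax_cond.
Qed.

Lemma outdegU1 F u a : u \notin F -> outdeg F a = (a u + outdeg (u |: F) a)%N.
Proof.
move=> uF; rewrite /outdeg (bigD1 u) //=; congr addn.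
by apply: eq_bigl => i; rewrite in_setU1 negb_or andbC.
Qed.

Lemma outdegI G G' a : (outdeg (G :&: G') a <= outdeg G a + outdeg G' a)%N.
Proof.
rewrite /outdeg [leqLHS]big_mkcond [X in (_ <= X + _)%N]big_mkcond.
rewrite [X in (_ <= _ + X)%N]big_mkcond -big_split; apply: leq_sum => i _.
rewrite inE negb_and; case: (i \in G); case: (i \in G') => //=.
  by rewrite leq_addr.
by rewrite leq_addr.
Qed.

Hypothesis hpure : pure D.
Hypothesis diam2 : forall F, F \in faces D -> 1 <= complex_dim (link D F) ->
  skeleton_diam_le (link D F) 2.

(** The labelling [e] is arbitrary; in [glue] it is the coefficient of x^a on each facet. Induction
    on #|G| - #|G :&: G'|, where the value 1 is the hypothesis. *)
Lemma strongly_connected (T : Type) (e : {set 'I_n} -> T) F0 a :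
    (forall G G', G \in facets D -> G' \in facets D -> F0 \subset G ->
       F0 \subset G' -> (outdeg G a <= 1)%N -> (outdeg G' a <= 1)%N ->
       #|G :&: G'|.+1 = #|G| -> e G = e G') ->
  forall G G', G \in facets D -> G' \in facets D -> F0 \subset G ->
    F0 \subset G' -> (outdeg G a <= 1)%N -> (outdeg G' a <= 1)%N -> e G = e G'.
Proof.
move=> adj G G' GD G'D F0G F0G' Ga G'a.
have [k] := ubnP (#|G| - #|G :&: G'|); elim: k G G' GD G'D F0G F0G' Ga G'a => // k IHk.
move=> G G' GD G'D F0G F0G' Ga G'a lek.
have leI : (#|G :&: G'| <= #|G|)%N by rewrite subset_leq_card ?subsetIl.
case: (ltngtP (#|G| - #|G :&: G'|) 1) => [|gt1|e1]; last 1 first.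
- by apply: adj => //; rewrite -add1n -e1 subnK.
- rewrite ltnS leqn0 subn_eq0 => GI; have /eqP eI : G :&: G' == G.
    by rewrite eqEcard subsetIl.
  by rewrite (facet_max GD (facets_faces G'D)) // -eI subsetIr.
set F := G :&: G' in leI lek gt1.
have FG : F \subset G := subsetIl _ _; have FG' : F \subset G' := subsetIr _ _.
have F0F : F0 \subset F by rewrite subsetI F0G.
have FD : F \in faces D by apply: faces_sub (facets_faces GD) _.
have cardG H : H \in facets D -> #|H| = #|G| by move=> HD; apply: hpure.
have neGG' : forall A B, A \in facets D -> B \in facets D -> F :=: A :&: B ->
    exists2 u, u \in A & u \notin F.
  move=> A B AD BD eF; apply/subsetPn; apply: contraTN gt1 => /subset_leq_card.
  by rewrite cardG // -subn_eq0 => /eqP->.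
have dimF : 1 <= complex_dim (link D F).
  apply/complex_dim_linkP; exists (G :\: F).
    apply/in_linkP; split; last by rewrite setIC setIDA setIC -setIDA setDv setI0.
    by rewrite setUC setDE setUIr setUCr setIT (setUidPr FG) facets_faces.
  by rewrite cardsD (setIidPr FG).
(* If a has outside degree at most 1 at F, any u and v will do. Otherwise take them with a u and a v
   positive: the outside degree at F is at most 2, so adding u or v to F brings it down to at most
   1. *)
have [u [v [uG vG' uF vF uvP]]] : exists u v, [/\ u \in G, v \in G', u \notin F,
    v \notin F & forall H, F \subset H -> (u \in H) || (v \in H) -> (outdeg H a <= 1)%N].
  have [le1|gt1'] := leqP (outdeg F a) 1.
    have [u uG uF] := neGG' G G' GD G'D erefl.
    have [v vG' vF] := neGG' G' G G'D GD (setIC _ _).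
    exists u, v; split=> // H FH _; exact: leq_trans (leq_odeg a FH) le1.
  have pickH A : (outdeg A a <= 1)%N -> F \subset A ->
      exists u, [/\ u \in A, u \notin F & (0 < a u)%N].
    move=> A1 FA; apply/not_existsP => H.
    have : (outdeg F a <= outdeg A a)%N; last by rewrite leqNgt (leq_ltn_trans A1).
    rewrite /outdeg [leqLHS]big_mkcond [leqRHS]big_mkcond; apply: leq_sum => i _.
    have [iF|iF] /= := boolP (i \in F); first by [].
    have [iA|//] /= := boolP (i \in A).
    by rewrite leqNgt; apply/negP => ai; apply: (H i).
  have [u [uG uF au]] := pickH G Ga FG; have [v [vG' vF av]] := pickH G' G'a FG'.
  have le2 : (outdeg F a <= 2)%N.
    by apply: leq_trans (outdegI _ _ _) _; apply: (leq_add Ga G'a).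
  have bound w H : w \notin F -> (0 < a w)%N -> F \subset H -> w \in H ->
      (outdeg H a <= 1)%N.
    move=> wF aw FH wH; rewrite (outdegU1 a wF) in le2.
    have wFH : w |: F \subset H by rewrite subUset sub1set wH.
    apply: leq_trans (leq_odeg a wFH) _.
    by move: le2; case: (a w) aw => // b _; rewrite addSn ltnS; apply: leq_trans; rewrite leq_addl.
  by exists u, v; split=> // H FH /orP[]; apply: bound.
have linkF w A : A \in faces D -> F \subset A -> w \in A -> w \notin F -> [set w] \in link D F.
  move=> AD FA wA wF; apply/in_linkP; split.
    by apply: faces_sub AD _; rewrite subUset sub1set wA.
  by apply/eqP; rewrite setI_eq0 disjoints1.
have [p [pP lp sp]] := diam2 FD dimF (linkF u G (facets_faces GD) FG uG uF)
  (linkF v G' (facets_faces G'D) FG' vG' vF).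
(* Facets sharing F and a further vertex w meet in more than F, so the induction hypothesis applies
   to them. *)
have step A B w : A \in facets D -> B \in facets D -> F \subset A -> F \subset B ->
    w \notin F -> w \in A -> w \in B -> (outdeg A a <= 1)%N -> (outdeg B a <= 1)%N ->
    e A = e B.
  move=> AD BD FA FB wF wA wB Aa Ba; apply: IHk => //; try exact: subset_trans F0F _.
  have : (#|F| < #|A :&: B|)%N.
    apply/proper_card/properP; split; first by rewrite subsetI FA.
    by exists w; rewrite // inE wA.
  rewrite (cardG A) // => ltF; rewrite -ltnS; apply: leq_trans lek.
  rewrite ltnS ltn_sub2l //.
  by apply: leq_trans ltF _; rewrite -(cardG A AD) subset_leq_card ?subsetIl.
have edge x y : skeleton_edge (link D F) x y -> exists B,
    [/\ B \in facets D, F \subset B, x \in B, y \in B & (x \notin F) && (y \notin F)].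
  move=> /andP[_ /in_linkP[xyF /setP xyF0]].
  have [B BD xyB] := face_in_facet xyF; exists B.
  move: xyB; rewrite !subUset !sub1set -andbA => /and3P[-> -> ->].
  split=> //; have := xyF0 x; have := xyF0 y.
  by rewrite !inE !eqxx orbT /= => -> ->.
(* Length 0 would put u = v in F. Length 1 yields a facet through u and v; length 2 yields facets
   through u, w and through w, v. *)
case: p pP lp sp => [|w [|z [|//]]] /=.
- by move=> _ euv; case/negP: uF; rewrite inE uG {1}euv.
- rewrite andbT => /edge[B [BD FB uB wB _]] ew _; rewrite ew in wB.
  have Ba : (outdeg B a <= 1)%N by apply: uvP; rewrite ?uB.
  by rewrite (step G B u) // (step B G' v).
- rewrite andbT => /andP[/edge[B [BD FB uB wB /andP[_ wF]]] /edge[C [CD FC wC zC _]]] ez _.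
  rewrite ez in zC.
  have Ba : (outdeg B a <= 1)%N by apply: uvP; rewrite ?uB.
  have Ca : (outdeg C a <= 1)%N by apply: uvP; rewrite ?zC ?orbT.
  by rewrite (step G B u) // (step B C w) // (step C G' v).
Qed.

(** The e_G may be changed by elements of P_G^2, so only coefficients of outside degree at most 1
    matter. These agree on facets adjacent in codimension one, where f or g can be cancelled, and
    then on all facets by [strongly_connected]. *)
Lemma glue (K : fieldType) (e : {set 'I_n} -> {mpoly K[n]}) F0 (f g pf pg : {mpoly K[n]}) :
    (forall G, G \in facets D -> F0 \subset G ->
       Ppow G 2 (f * e G - pf) /\ Ppow G 2 (g * e G - pg)) ->
    (forall G G', G \in facets D -> G' \in facets D -> F0 \subset G -> F0 \subset G' ->
       #|G :&: G'|.+1 = #|G| -> ~ Ppow (G :&: G') 1 f \/ ~ Ppow (G :&: G') 1 g) ->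
  exists p, forall G, G \in facets D -> F0 \subset G -> Ppow G 2 (e G - p).
Proof.
move=> fgP codim1.
pose ok a G := [&& G \in facets D, F0 \subset G & (outdeg G a <= 1)%N].
(* The coefficient of x^a is copied from one chosen facet with outside degree of a at most 1, and is
   0 if there is none. *)
exists (\sum_(G : {set 'I_n}) mcut (fun a => [pick H | ok a H] == Some G) (e G)).
move=> G GD F0G a; rewrite ltnS => Ga.
rewrite mcoeffB raddf_sum /=; under eq_bigr do rewrite mcoeff_mcut.
case: pickP => [H /and3P[HD F0H Ha]|/(_ G)]; last by rewrite /ok GD F0G Ga.
rewrite (bigD1 H) //= eqxx [X in _ - (_ + X)]big1 ?addr0; last first.
  by move=> B BH; case: eqP => // -[] eB; rewrite eB eqxx in BH.
apply/eqP; rewrite subr_eq0; apply/eqP; move: G H GD HD F0G F0H Ga Ha.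
apply: strongly_connected => G H GD HD F0G F0H Ga Ha GH1.
apply/eqP; rewrite -subr_eq0 -mcoeffB; apply/eqP.
(* The exponents outside [J] are those not in P_G^2 + P_H^2, a monomial ideal insensitive to the
   variables of G :&: H. *)
have glue1 s ps : ~ Ppow (G :&: H) 1 s -> Ppow G 2 (s * e G - ps) ->
    Ppow H 2 (s * e H - ps) -> (e G - e H)@_a = 0.
  move=> sF sG sH.
  apply: (@monomial_primary _ _ (G :&: H)
    (fun m => (2 <= outdeg G m)%N || (2 <= outdeg H m)%N) s) => //.
  - move=> m m' /orP[] le2; apply/orP; [left|right];
      by rewrite outdegD (leq_trans le2) ?leq_addr.
  - move=> m m' m'0; rewrite !outdegD.
    have : (outdeg G m' == 0)%N by rewrite -leqn0 -m'0 leq_odeg ?subsetIl.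
    have : (outdeg H m' == 0)%N by rewrite -leqn0 -m'0 leq_odeg ?subsetIr.
    by move=> /eqP-> /eqP->; rewrite !addn0.
  - move=> m; rewrite negb_or -!ltnNge => /andP[mG mH].
    have -> : s * (e G - e H) = (s * e G - ps) - (s * e H - ps) by ring.
    by rewrite mcoeffB sG // sH // subrr.
  - by rewrite negb_or -!ltnNge ltnS Ga ltnS Ha.
have [fG gG] := fgP G GD F0G; have [fH gH] := fgP H HD F0H.
by have [sF|sF] := codim1 G H GD HD F0G F0H GH1; [apply: glue1 fG fH|apply: glue1 gG gH].
Qed.

End StrongConnectivity.

(** * Primes of the polynomial ring *)

Section PrimeSet.
Variable R : comNzRingType.
Implicit Types (Q : R -> Prop) (f g : R).

Record prime_set Q : Prop := PrimeSet {
  prime_set0 : Q 0;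
  prime_set1 : ~ Q 1;
  prime_setD : forall f g, Q f -> Q g -> Q (f + g);
  prime_setM : forall f g, Q g -> Q (f * g);
  prime_setP : forall f g, Q (f * g) -> Q f \/ Q g
}.

Lemma prime_set_sum Q (I : Type) (r : seq I) (P : pred I) (h : I -> R) :
  prime_set Q -> (forall i, P i -> Q (h i)) -> Q (\sum_(i <- r | P i) h i).
Proof. by move=> QP; apply: big_ind; [exact: prime_set0|exact: prime_setD]. Qed.

Lemma prime_set_prod Q (I : Type) (r : seq I) (P : pred I) (h : I -> R) :
  prime_set Q -> (forall i, P i -> ~ Q (h i)) -> ~ Q (\prod_(i <- r | P i) h i).
Proof.
move=> QP; apply: (big_ind (fun x => ~ Q x)); first exact: prime_set1.
by move=> x y xQ yQ /(prime_setP QP)[].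
Qed.

Lemma prime_setB Q f g : prime_set Q -> Q f -> Q g -> Q (f - g).
Proof. by move=> QP Qf Qg; rewrite -mulN1r; apply: prime_setD => //; apply: prime_setM. Qed.

End PrimeSet.

Section PrimeSets.
Variables (K : fieldType) (n : nat) (D : simplicial_complex n).
Implicit Types (F G : {set 'I_n}) (f g a s : {mpoly K[n]}).
Implicit Types (Q : {mpoly K[n]} -> Prop) (v : 'I_n -> K).

Lemma prime_set_Ppow Q F f : prime_set Q -> (forall i, i \notin F -> Q 'X_i) ->
  Ppow F 1 f -> Q f.
Proof.
move=> QP QF /PpowE ->; apply: prime_set_sum => // m /outdeg_gt0P[i iF mi].
rewrite -mul_mpolyC; apply: (prime_setM QP).
rewrite -(@submK _ U_(i) m) ?lep1mP -?lt0n // mpolyXD.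
by apply: prime_setM => //; apply: QF.
Qed.

Lemma prime_set_hpart0 Q F f : prime_set Q -> (forall i, i \notin F -> Q 'X_i) ->
  Q f <-> Q (hpart F 0 f).
Proof.
move=> QP QF; have fr := prime_set_Ppow QP QF (@sub_hpart0_Ppow _ _ F f).
split=> Qf; last by rewrite -[f](subrK (hpart F 0 f)); apply: prime_setD.
by rewrite -[hpart F 0 f](subKr f); apply: prime_setB.
Qed.

(** Otherwise every facet misses a variable that is not in Q; the product of the squares of such
    variables lies in the symbolic square, hence in Q, against primality. *)
Lemma prime_set_facet Q : prime_set Q -> (forall f, f \in symbolic_square K D -> Q f) ->
  exists2 G, G \in facets D & forall i, i \notin G -> Q 'X_i.
Proof.
move=> QP QI; apply: contrapT => H.
pose h G : {mpoly K[n]} :=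
  if [pick i | (i \notin G) && `[< ~ Q 'X_i >]] is Some i then 'X_i else 1.
have hQ G : ~ Q (h G).
  by rewrite /h; case: pickP => [i /andP[_ /asboolP]|_] //; exact: prime_set1.
have hG G : G \in facets D -> Ppow G 1 (h G).
  move=> GD; rewrite /h; case: pickP => [i /andP[iG _]|none]; first exact: PpowXU.
  case: H; exists G => // i iG; apply: contrapT => nQ.
  by have := none i; rewrite iG asboolT.
apply: (@prime_set_prod _ Q _ (enum (facets D)) xpredT (fun G => h G * h G) QP).
  by move=> G _ /(prime_setP QP)[]/hQ.
apply: QI; apply/symbolic_squareP => G GD.
rewrite (bigD1_seq G) /=; [|by rewrite mem_enum|exact: enum_uniq].
by apply: PpowMr; apply: (PpowM (hG G GD) (hG G GD)).
Qed.

(** The kernel of evaluation at v is a prime containing the variables outside G. *)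
Lemma meval_Ppow G f v : (forall i, i \notin G -> v i = 0) -> Ppow G 1 f -> f.@[v] = 0.
Proof.
move=> v0 fG; pose Q f := f.@[v] = 0; apply: (@prime_set_Ppow Q G) fG.
  split; rewrite /Q; first exact: meval0.
  - by rewrite meval1; apply/eqP/oner_neq0.
  - by move=> x y x0 y0; rewrite mevalD x0 y0 addr0.
  - by move=> x y y0; rewrite mevalM y0 mulr0.
  - by move=> x y /eqP; rewrite mevalM mulf_eq0 => /orP[]/eqP; [left|right].
by move=> i iG; rewrite /Q mevalXU v0.
Qed.

Lemma meval_hpart0 G f v : (forall i, i \notin G -> v i = 0) ->
  (hpart G 0 f).@[v] = f.@[v].
Proof.
move=> v0; apply/eqP; rewrite eq_sym -subr_eq0 -mevalB.
by rewrite (meval_Ppow v0) //; apply: sub_hpart0_Ppow.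
Qed.

Lemma msize1_unit (f : {mpoly K[n]}) : f != 0 -> (msize f <= 1)%N -> f \is a GRing.unit.
Proof.
move=> f0 /msize1_polyC e; rewrite e; apply: rmorph_unit; rewrite unitfE.
by apply: contraNneq f0 => e0; rewrite e e0 mpolyC0.
Qed.

Lemma msize_hpart G k f : (msize (hpart G k f) <= msize f)%N.
Proof.
rewrite msizeE; apply/bigmax_leqP_seq => m mf _; apply: msize_mdeg_lt.
by move: mf; rewrite !mcoeff_msupp mcoeff_hpart; case: ifP => //; rewrite eqxx.
Qed.

(** [msize] is the total degree plus one, so in any factorization one factor is constant. *)
Lemma linear_prime f : f != 0 -> f \isn't a GRing.unit -> (msize f <= 2)%N -> prime_elt f.
Proof.
move=> f0 fU f2; apply: irreducible_prime => //; first exact: mpoly_factorial.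
move=> a b e; have a0 : a != 0 by apply: contraNneq f0 => a0; rewrite e a0 mul0r.
have b0 : b != 0 by apply: contraNneq f0 => b0; rewrite e b0 mulr0.
move: f2; rewrite e msizeM // => ab2.
have [/(msize1_unit a0)->//|a1] := leqP (msize a) 1.
rewrite (msize1_unit b0) ?orbT //; move: (msize a) (msize b) ab2 a1 => x y; lia.
Qed.

Lemma Ppow_prime G : prime_set (@Ppow K n G 1).
Proof.
split; first by move=> m _; rewrite mcoeff0.
- move/(meval_Ppow (v := fun=> 0) (fun _ _ => erefl))/eqP.
  by rewrite meval1 oner_eq0.
- by move=> f g; apply: PpowD.
- by move=> f g; apply: PpowMl.
- move=> f g fg; have [fG|fG] := EM (Ppow G 1 f); first by left.
  by right; apply: Ppow_primary fg.
Qed.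

Lemma prod_facet_Ppow G F : ~~ (F \subset G) ->
  Ppow G 2 ((\prod_(i in F) 'X_i : {mpoly K[n]}) ^+ 2).
Proof.
move=> /subsetPn[i iF iG]; rewrite (bigD1 i) //= exprMn; apply: PpowMr.
by rewrite expr2; apply: (@PpowM _ _ _ 1 1); apply: PpowXU.
Qed.

End PrimeSets.

(** * Regular pairs in a prime *)

Section RegularPair.
Variables (K : fieldType) (n : nat) (D : simplicial_complex n).
Implicit Types (E F G : {set 'I_n}) (f g a s : {mpoly K[n]}).
Implicit Types (Q : {mpoly K[n]} -> Prop) (v : 'I_n -> K).

Definition linear_form F : {mpoly K[n]} := \sum_(i | i \notin F) 'X_i.

Lemma meval_linear_form F v : (linear_form F).@[v] = \sum_(i | i \notin F) v i.
Proof. by rewrite raddf_sum; apply: eq_bigr => i _; rewrite /= mevalXU. Qed.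

(** Evaluate at the basis vector of u: the form takes the value 1, while P_E vanishes there. *)
Lemma linear_form_notin F E u : u \in E -> u \notin F -> ~ Ppow E 1 (linear_form F).
Proof.
move=> uE uF; pose v i : K := (i == u)%:R.
have v0 i : i \notin E -> v i = 0.
  by move=> iE; rewrite /v; case: eqP iE => // ->; rewrite uE.
move/(meval_Ppow v0)/eqP; rewrite meval_linear_form (bigD1 u) //= /v eqxx big1.
  by rewrite addr0 oner_eq0.
by move=> i /andP[_ /negPf->].
Qed.

Lemma linear_form_prime F G u : u \in G -> u \notin F ->
  prime_elt (hpart G 0 (linear_form F)).
Proof.
move=> uG uF; have f0 : hpart G 0 (linear_form F) != 0.
  by apply/eqP => /hpart0_eq0; apply: linear_form_notin uG uF.
apply: linear_prime => //.
  apply/negP => /(rmorph_unit (meval (fun=> 0))) /=.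
  by rewrite meval_hpart0 // meval_linear_form big1 // unitr0.
apply: leq_trans (msize_hpart _ _ _) _; rewrite /linear_form.
apply: leq_trans (msize_sum _ _ _) _; apply/bigmax_leqP => i _.
by rewrite msizeX mdeg1.
Qed.

(** The second elementary symmetric polynomial in the variables outside F. *)
Definition quadratic_form F : {mpoly K[n]} :=
  \sum_(p : 'I_n * 'I_n | [&& p.1 \notin F, p.2 \notin F & (p.1 < p.2)%N])
    'X_p.1 * 'X_p.2.

(** At the point with coordinate 1 at u, -1 at w and 0 elsewhere, the linear form vanishes and the
    quadratic one is -1. *)
Lemma linear_quadratic_coprime F G u w : u \in G -> w \in G ->
  u \notin F -> w \notin F -> (u < w)%N ->
  ~ divides (hpart G 0 (linear_form F)) (hpart G 0 (quadratic_form F)).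
Proof.
move=> uG wG uF wF ltuw [c].
pose v i : K := (i == u)%:R - (i == w)%:R.
have v0 i : i \notin G -> v i = 0.
  move=> iG; rewrite /v; case: eqP => [e|_]; first by rewrite e uG in iG.
  by case: eqP => [e|_]; rewrite ?subrr //; rewrite e wG in iG.
have uw : (u == w) = false by rewrite -val_eqE /= ltn_eqF.
move/(congr1 (meval v)); rewrite mevalM !meval_hpart0 // meval_linear_form.
rewrite (bigD1 u) //= (bigD1 w) /= ?wF 1?eq_sym ?uw // big1; last first.
  by move=> i /andP[/andP[_ iu] iw]; rewrite /v (negPf iu) (negPf iw) subrr.
rewrite /v !eqxx uw eq_sym uw subr0 addr0 sub0r subrr mulr0.
rewrite raddf_sum /= (bigD1 (u, w)) /= ?uF ?wF // big1; last first.
  move=> [i j] /= /andP[/and3P[_ _ ltij]]; rewrite xpair_eqE negb_and => H.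
  rewrite mevalM !mevalXU.
  have [ei|iu] := eqVneq i u.
    rewrite ei eqxx /= in H ltij *.
    by rewrite (negPf H) (_ : (j == u) = false) ?subrr ?mulr0 // -val_eqE /= gtn_eqF.
  have [ei|iw] := eqVneq i w; last by rewrite subrr mul0r.
  have jw : (j == w) = false by rewrite -val_eqE /= -ei gtn_eqF.
  have ju : (j == u) = false by rewrite -val_eqE /= gtn_eqF // (ltn_trans ltuw) // -ei.
  by rewrite jw ju subrr mulr0.
rewrite mevalM !mevalXU !eqxx uw eq_sym uw subr0 sub0r mul1r addr0 => /eqP.
by rewrite oppr_eq0 oner_eq0.
Qed.

Hypothesis hpure : pure D.

Definition invertible_vars Q : {set 'I_n} := [set i | `[< ~ Q 'X_i >]].

Lemma invertible_varsP Q i : i \notin invertible_vars Q -> Q 'X_i.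
Proof. by rewrite inE => /asboolPn/contrapT. Qed.

Lemma invertible_vars_sub Q G : (forall i, i \notin G -> Q 'X_i) -> invertible_vars Q \subset G.
Proof.
by move=> QG; apply/subsetP => i; rewrite inE => /asboolP nQ; apply/negPn/negP => /QG.
Qed.

(* By regular_mod_square, this makes (f, g) a regular sequence on S/P_G^2 for
   all facets G containing F. *)
Definition regular_over F f g := forall G, G \in facets D -> F \subset G ->
  hpart G 0 f != 0 /\
  forall a, divides (hpart G 0 f) (hpart G 0 g * a) -> divides (hpart G 0 f) a.

Section RegularPairCases.
Variable Q : {mpoly K[n]} -> Prop.
Hypothesis QP : prime_set Q.
Let F := invertible_vars Q.
Variable G0 : {set 'I_n}.
Hypotheses (G0D : G0 \in facets D) (FG0 : F \subset G0).

Let cardG G : G \in facets D -> #|G| = #|G0|. Proof. by move=> GD; apply: hpure. Qed.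

Lemma linear_form_in : Q (linear_form F).
Proof. by apply: prime_set_sum => // i /invertible_varsP. Qed.

(** Every facet above F has two vertices outside F, so [linear_quadratic_coprime] applies; a
    codimension one set E still has one, so the linear form avoids P_E. *)
Lemma regular_pair_codim2 : (#|F|.+2 <= #|G0|)%N -> exists f g,
  [/\ Q f, Q g, regular_over F f g &
    forall E, F \subset E -> #|E|.+1 = #|G0| -> ~ Ppow E 1 f \/ ~ Ppow E 1 g].
Proof.
move=> F2; exists (linear_form F), (quadratic_form F); split.
- exact: linear_form_in.
- apply: prime_set_sum => // -[i j] /= /and3P[_ jF _].
  by apply: prime_setM => //; apply: invertible_varsP.
- move=> G GD FG; have : (1 < #|G :\: F|)%N.
    by rewrite cardsD (setIidPr FG) cardG // ltn_subRL addn1.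
  case/card_gt1P => x [y [/setDP[xG xF] /setDP[yG yF] xy]].
  have [u [w [uG wG uF wF uw]]] : exists u w : 'I_n,
      [/\ u \in G, w \in G, u \notin F, w \notin F & (u < w)%N].
    case: (ltngtP x y) => [xy'|yx|/val_inj/eqP]; last by rewrite (negPf xy).
      by exists x, y.
    by exists y, x.
  have pr := linear_form_prime uG uF; split; first by case: pr.
  by move=> a; apply: (prime_elt_coprime pr); apply: linear_quadratic_coprime uw.
- move=> E FE cE; left; have [u uE uF] : exists2 u, u \in E & u \notin F.
    by apply/subsetPn/negP => /subset_leq_card; move: F2 cE; lia.
  exact: linear_form_notin uE uF.
Qed.

(** Here E can only be F, and g avoids P_F. Since the linear form lies in P_F, it does not divide g
    modulo P_G either. *)
Lemma regular_pair_codim1 g : #|F|.+1 = #|G0| -> Q g -> ~ Ppow F 1 g -> exists f g,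
  [/\ Q f, Q g, regular_over F f g &
    forall E, F \subset E -> #|E|.+1 = #|G0| -> ~ Ppow E 1 f \/ ~ Ppow E 1 g].
Proof.
move=> F1 Qg gF; exists (linear_form F), g; split=> //.
- exact: linear_form_in.
- move=> G GD FG; have [u uG uF] : exists2 u, u \in G & u \notin F.
    by apply/subsetPn/negP => /subset_leq_card; rewrite cardG // -F1 ltnn.
  have pr := linear_form_prime uG uF; split; first by case: pr.
  move=> a; apply: (prime_elt_coprime pr) => -[c ec]; apply: gF.
  have FP := @Ppow_prime K n F.
  have PF E f : F \subset E -> Ppow F 1 f <-> Ppow F 1 (hpart E 0 f).
    move=> FE; apply: (prime_set_hpart0 f FP) => i iE; apply: PpowXU.
    by apply: contraNN iE; apply: (subsetP FE).
  apply: (PF G g FG).2; rewrite ec; apply: PpowMl; apply: (PF G _ FG).1.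
  by apply: Ppow_sum => i; apply: PpowXU.
- move=> E FE cE; right; suff <- : F = E by [].
  by apply/eqP; rewrite eqEcard FE; move: cE F1; lia.
Qed.

Variables Q0 Q1 : {mpoly K[n]} -> Prop.
Hypotheses (Q0P : prime_set Q0) (Q1P : prime_set Q1).
Hypotheses (Q01 : forall f, Q0 f -> Q1 f) (Q1Q : forall f, Q1 f -> Q f).
Hypothesis G0Q0 : forall i, i \notin G0 -> Q0 'X_i.

(** Suppose Q lies in P_F. Modulo P_G0, the ideal P_F is generated by x_v, where G0 is F with v
    added. Splitting x_v off an element of Q1 outside P_G0 must end with x_v in Q1; then Q1 contains
    P_F, hence Q, against strictness of the chain. *)
Lemma chain_not_in_face_ideal f1 g : #|F|.+1 = #|G0| -> Q1 f1 -> ~ Q0 f1 -> Q g -> ~ Q1 g ->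
  exists2 h, Q h & ~ Ppow F 1 h.
Proof.
move=> F1 Q1f1 Q0f1 Qg Q1g; apply: contrapT => noh.
have QF h : Q h -> Ppow F 1 h by move=> Qh; apply: contrapT => hF; apply: noh; exists h.
have Q0G0 f : Ppow G0 1 f -> Q0 f by apply: prime_set_Ppow.
have Q1G0 i : i \notin G0 -> Q1 'X_i by move=> iG0; apply/Q01/G0Q0.
have [v vG0 vF] : exists2 v, v \in G0 & v \notin F.
  by apply/subsetPn/negP => /subset_leq_card; rewrite -F1 ltnn.
have G0E i : i \in G0 -> i \notin F -> i = v.
  have /eqP eG0 : v |: F == G0.
    by rewrite eqEcard subUset sub1set vG0 FG0 cardsU1 vF add1n F1 leqnn.
  by rewrite -eG0 => /setU1P[//|->].
suff Q1v : Q1 'X_v.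
  apply: Q1g; apply: (@prime_set_Ppow _ _ Q1 F) (QF g Qg) => // i iF.
  have [iG0|iG0] := boolP (i \in G0); last exact: Q1G0.
  by rewrite (G0E i).
suff descent m f : Q1 f -> ~ Ppow G0 1 f -> (msize f < m)%N -> Q1 'X_v.
  by apply: (descent (msize f1).+1 f1) => // /Q0G0.
elim: m f => // m IHm f Q1f fG0 lem; pose h := hpart G0 0 f.
have Q1h : Q1 h by apply: (prime_set_hpart0 f Q1P Q1G0).1.
have h0 : h != 0 by apply/eqP => /hpart0_eq0.
(* A monomial of h involves only variables of G0 and, as h lies in P_F, one of them is outside F: it
   is x_v. *)
have hX : h = (\sum_(k <- msupp h) h@_k *: 'X_[k - U_(v)]) * 'X_v.
  rewrite mulr_suml {1}(mpolyE h) big_seq [RHS]big_seq; apply: eq_bigr => k kh.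
  rewrite -scalerAl -mpolyXD submK // lep1mP -lt0n.
  have /outdeg_gt0P[i iF ki] : (0 < outdeg F k)%N.
    rewrite ltnNge leqn0; apply/negP => /eqP kF; move: kh.
    by rewrite mcoeff_msupp (QF _ (Q1Q Q1h)) ?eqxx // kF.
  have [iG0|iG0] := boolP (i \in G0); first by rewrite -(G0E i).
  move: kh; rewrite mcoeff_msupp mcoeff_hpart; case: ifP; last by rewrite eqxx.
  by rewrite outdeg_eq0 => /forall_inP/(_ i iG0)/eqP ki0; rewrite ki0 in ki.
set b := (\sum_(k <- _) _) in hX.
have b0 : b != 0 by apply: contraNneq h0 => b0; rewrite hX b0 mul0r.
have X0 : ('X_v : {mpoly K[n]}) != 0 by apply: contraNneq h0 => X0; rewrite hX X0 mulr0.
rewrite hX in Q1h; case: (prime_setP Q1P Q1h) => // Q1b; apply: (IHm b) => //.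
  move=> bG0; apply: fG0; apply/hpart0_eq0; rewrite -hpart_id.
  by apply/hpart0_eq0; rewrite -/h hX; apply: PpowMr.
have := msize_hpart G0 0 f; rewrite -/h hX msizeM // msizeX mdeg1.
have bS : (0 < msize b)%N by rewrite lt0n msize_poly_eq0.
by move: lem bS; move: (msize f) (msize b) => x y; lia.
Qed.

(** Now F = G0 is the only facet above F. Modulo P_G0, a nonzero element f of Q1 of least degree is
    irreducible, hence prime, and cannot divide g, which is not in Q1. No E of codimension one
    contains F. *)
Lemma regular_pair_codim0 f1 g : #|F| = #|G0| -> Q1 f1 -> ~ Q0 f1 -> Q g -> ~ Q1 g ->
  exists f g, [/\ Q f, Q g, regular_over F f g &
    forall E, F \subset E -> #|E|.+1 = #|G0| -> ~ Ppow E 1 f \/ ~ Ppow E 1 g].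
Proof.
move=> F0 Q1f1 Q0f1 Qg Q1g.
have Q0G0 f : Ppow G0 1 f -> Q0 f by apply: prime_set_Ppow.
have Q1G0 i : i \notin G0 -> Q1 'X_i by move=> iG0; apply/Q01/G0Q0.
have [f [Q1f f0 ef fmin]] : exists f, [/\ Q1 f, f != 0, hpart G0 0 f = f &
    forall h, Q1 h -> h != 0 -> hpart G0 0 h = h -> (msize f <= msize h)%N].
  suff minI m f : Q1 f -> f != 0 -> hpart G0 0 f = f -> (msize f < m)%N ->
     exists f, [/\ Q1 f, f != 0, hpart G0 0 f = f &
    forall h, Q1 h -> h != 0 -> hpart G0 0 h = h -> (msize f <= msize h)%N].
    apply: (minI (msize (hpart G0 0 f1)).+1 (hpart G0 0 f1)) => //.
    - exact: (prime_set_hpart0 f1 Q1P Q1G0).1.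
    - by apply/eqP => /hpart0_eq0/Q0G0.
    - exact: hpart_id.
  elim: m f => // m IHm f Q1f f0 ef lem.
  have [[h [Q1h h0 eh lth]]|H] :=
    EM (exists h, [/\ Q1 h, h != 0, hpart G0 0 h = h & (msize h < msize f)%N]).
    by apply: (IHm h) => //; apply: leq_trans lth _; rewrite -ltnS.
  exists f; split=> // h Q1h h0 eh; rewrite leqNgt; apply/negP => lth.
  by apply: H; exists h.
have unit1 h : h \is a GRing.unit -> ~ Q1 h.
  by move=> hU Q1h; apply: (prime_set1 Q1P); rewrite -(mulVr hU); apply: prime_setM.
have fP : prime_elt f.
  apply: irreducible_prime => //; first exact: mpoly_factorial.
    by apply/negP => /unit1.
  (* A factor a in Q1 has degree at least that of f by minimality, so the other factor is
     constant. *)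
  suff half a b : f = a * b -> Q1 (hpart G0 0 a) -> b \is a GRing.unit.
    move=> a b e; have [] := prime_setP Q1P (f := hpart G0 0 a) (g := hpart G0 0 b).
    - by rewrite -hpart0M -e ef.
    - by move/(half a b e) => ->; rewrite orbT.
    - by rewrite mulrC in e; move/(half b a e) => ->.
  move=> e Q1a; have e0 : f = hpart G0 0 a * hpart G0 0 b by rewrite -hpart0M -e ef.
  have a0 : a != 0 by apply: contraNneq f0 => a0; rewrite e a0 mul0r.
  have b0 : b != 0 by apply: contraNneq f0 => b0; rewrite e b0 mulr0.
  have a00 : hpart G0 0 a != 0 by apply: contraNneq f0 => h; rewrite e0 h mul0r.
  apply: msize1_unit => //; have := fmin _ Q1a a00 (hpart_id _ _ _).
  have := msize_hpart G0 0 a; rewrite e msizeM //.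
  have aS : (0 < msize a)%N by rewrite lt0n msize_poly_eq0.
  by move: aS; move: (msize (hpart G0 0 a)) (msize a) (msize b) => x y z; lia.
exists f, g; split; [exact: Q1Q|by []| |].
- move=> G GD FG; suff -> : G = G0.
    rewrite ef; split=> // a; apply: (prime_elt_coprime fP) => -[c ec]; apply: Q1g.
    by apply: (prime_set_hpart0 g Q1P Q1G0).2; rewrite ec; apply: prime_setM.
  have eFG : F = G by apply/eqP; rewrite eqEcard FG cardG // F0 leqnn.
  by apply/eqP; rewrite -eFG eqEcard FG0 F0 leqnn.
- by move=> E /subset_leq_card; move: F0; lia.
Qed.

End RegularPairCases.

End RegularPair.

(** * Regular elements and pairs modulo the second symbolic power, locally at a prime *)

Section WeakRegularity.
Variables (K : fieldType) (n : nat) (D : simplicial_complex n).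
Hypothesis hpure : pure D.
Implicit Types (E F G : {set 'I_n}) (f g a s u : {mpoly K[n]}).
Variable Q : {mpoly K[n]} -> Prop.
Hypothesis QP : prime_set Q.
Let F := invertible_vars Q.

(** [G0] is a facet whose ideal lies in the bottom prime Q0; by purity, the codimension of F is the
    same in every facet containing it. *)
Lemma regular_pair Q0 Q1 f1 g1 :
    prime_set Q0 -> (forall f, f \in symbolic_square K D -> Q0 f) ->
    prime_set Q1 -> (forall f, Q0 f -> Q1 f) -> (forall f, Q1 f -> Q f) ->
    Q1 f1 -> ~ Q0 f1 -> Q g1 -> ~ Q1 g1 ->
  exists f g, [/\ Q f, Q g, regular_over D F f g &
    forall G G', G \in facets D -> G' \in facets D -> F \subset G -> F \subset G' ->
      #|G :&: G'|.+1 = #|G| -> ~ Ppow (G :&: G') 1 f \/ ~ Ppow (G :&: G') 1 g].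
Proof.
move=> Q0P Q0I Q1P Q01 Q1Q Q1f1 Q0f1 Qg1 Q1g1.
have [G0 G0D G0Q0] := prime_set_facet Q0P Q0I.
have FG0 : F \subset G0 by apply: invertible_vars_sub => i /G0Q0/Q01/Q1Q.
suff [f [g [Qf Qg fg codim1]]] : exists f g,
  [/\ Q f, Q g, regular_over D F f g &
    forall E, F \subset E -> #|E|.+1 = #|G0| -> ~ Ppow E 1 f \/ ~ Ppow E 1 g].
  exists f, g; split=> // G G' GD G'D FG FG' GG'; apply: codim1.
    by rewrite subsetI FG.
  by rewrite GG'; apply: hpure.
case: (ltngtP #|F|.+1 #|G0|) => [F2|F0|F1].
- exact: regular_pair_codim2.
- have eF : #|F| = #|G0| by apply/eqP; rewrite eqn_leq subset_leq_card // -ltnS.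
  exact: (regular_pair_codim0 hpure G0D FG0 Q0P Q1P Q01 Q1Q G0Q0 eF Q1f1 Q0f1 Qg1 Q1g1).
- have [h Qh hF] := chain_not_in_face_ideal G0D FG0 Q0P Q1P Q01 Q1Q G0Q0 F1 Q1f1 Q0f1 Qg1 Q1g1.
  exact: regular_pair_codim1 Qh hF.
Qed.

(** If F is not a facet, the linear form works. Otherwise F is the only facet above itself, and P_F
    lies in Q0, which misses f1. *)
Lemma regular_element Q0 f1 :
    prime_set Q0 -> (forall f, f \in symbolic_square K D -> Q0 f) ->
    (forall f, Q0 f -> Q f) -> Q f1 -> ~ Q0 f1 ->
  exists2 f, Q f & forall G, G \in facets D -> F \subset G -> ~ Ppow G 1 f.
Proof.
move=> Q0P Q0I Q0Q Qf1 Q0f1.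
have [G0 G0D G0Q0] := prime_set_facet Q0P Q0I.
have FG0 : F \subset G0 by apply: invertible_vars_sub => i /G0Q0/Q0Q.
have cardG G : G \in facets D -> #|G| = #|G0| by move=> GD; apply: hpure.
have [lt|le] := ltnP #|F| #|G0|.
  exists (linear_form K F); first exact: linear_form_in.
  move=> G GD FG; have [u uG uF] : exists2 u, u \in G & u \notin F.
    by apply/subsetPn/negP => /subset_leq_card; rewrite cardG // leqNgt lt.
  exact: linear_form_notin uG uF.
exists f1 => // G GD FG /(prime_set_Ppow Q0P) H; apply/Q0f1/H => i iG; apply: G0Q0.
by apply: contraNN iG; have /eqP <- : F == G0; [rewrite eqEcard FG0|apply/subsetP].
Qed.

(** This element becomes invertible at Q and lies in P_G^2 for every facet G not containing F, so
    multiplying by it leaves only the facets above F to check. *)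
Let w : {mpoly K[n]} := (\prod_(i in F) 'X_i) ^+ 2.

Lemma invertible_prod : ~ Q w.
Proof.
have prodQ : ~ Q (\prod_(i in F) 'X_i).
  by apply: prime_set_prod => // i; rewrite inE => /asboolP.
by rewrite /w expr2 => /(prime_setP QP)[].
Qed.

Lemma local_symbolic_square a :
    (forall G, G \in facets D -> F \subset G -> Ppow G 2 a) ->
  w * a \in symbolic_square K D.
Proof.
move=> aP; apply/symbolic_squareP => G GD; have [FG|FG] := boolP (F \subset G).
  by apply/PpowMl/aP.
by apply/PpowMr/prod_facet_Ppow.
Qed.

Lemma unit_not_Ppow u G : ~ Q u -> F \subset G -> ~ Ppow G 1 u.
Proof.
move=> uQ FG uG; apply/uQ/(prime_set_Ppow QP _ (PpowS FG uG)) => i.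
exact: invertible_varsP.
Qed.

Lemma cancel_unit u a G : ~ Q u -> u * a \in symbolic_square K D ->
  G \in facets D -> F \subset G -> Ppow G 2 a.
Proof.
move=> uQ /symbolic_squareP uaI GD FG.
exact: Ppow_primary (unit_not_Ppow uQ FG) (uaI G GD).
Qed.

Lemma weakly_regular1 u f a :
    (forall G, G \in facets D -> F \subset G -> ~ Ppow G 1 f) ->
    ~ Q u -> u * (f * a) \in symbolic_square K D ->
  w * a \in symbolic_square K D.
Proof.
move=> fP uQ uI; apply: local_symbolic_square => G GD FG.
exact: Ppow_primary (fP G GD FG) (cancel_unit uQ uI GD FG).
Qed.

Hypothesis diam2 : forall F, F \in faces D -> 1 <= complex_dim (link D F) ->
  skeleton_diam_le (link D F) 2.

(** On each facet [regular_mod_square] gives e_G with a = f e_G modulo P_G^2. Then g e_G = h as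
    well, so the family e_G is carried into S/I by f and g, and [glue] applies. *)
Lemma weakly_regular2 u f g a h : regular_over D F f g ->
    (forall G G', G \in facets D -> G' \in facets D -> F \subset G -> F \subset G' ->
      #|G :&: G'|.+1 = #|G| -> ~ Ppow (G :&: G') 1 f \/ ~ Ppow (G :&: G') 1 g) ->
    ~ Q u -> u * (g * a - f * h) \in symbolic_square K D ->
  exists p, w * (a - f * p) \in symbolic_square K D.
Proof.
move=> fg codim1 uQ uI.
have /choice[e eP] G : exists e, G \in facets D -> F \subset G -> Ppow G 2 (a - f * e).
  have [GD|] := boolP (G \in facets D); last by exists 0.
  have [FG|] := boolP (F \subset G); last by exists 0.
  have [f0 cop] := fg G GD FG.
  have [c cP] := regular_mod_square cop f0 (cancel_unit uQ uI GD FG).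
  by exists c.
have [|p pP] := glue hpure diam2 (e := e) (pf := a) (pg := h) _ codim1.
  move=> G GD FG; have aP := eP G GD FG; have [f0 _] := fg G GD FG.
  have fe : Ppow G 2 (f * e G - a) by rewrite -opprB; apply: PpowN.
  (* As f is not in P_G, the relation g e_G = h may be checked after multiplication by f. *)
  split=> //; apply: (@Ppow_primary _ _ G 2 f); first by move/hpart0_eq0/eqP; apply/negP.
  have -> : f * (g * e G - h) = g * (f * e G - a) + (g * a - f * h) by ring.
  by apply: PpowD; [apply: PpowMl|apply: cancel_unit uQ uI GD FG].
exists p; apply: local_symbolic_square => G GD FG.
have -> : a - f * p = (a - f * e G) + f * (e G - p) by ring.
by apply: PpowD; [apply: eP|apply/PpowMl/pP].
Qed.

End WeakRegularity.

(** * Localization of a quotient ring *)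

Lemma prime_idealr_of_prime_set (R : comNzRingType) (Q : R -> Prop) :
  prime_set Q -> exists P : prime_idealr R, forall x, x \in P <-> Q x.
Proof.
move=> QP; pose S : {pred R} := fun x => `[< Q x >].
have SE x : x \in S <-> Q x by split=> /asboolP.
have Sid : idealr_closed S.
  split; first exact/SE/(prime_set0 QP).
    by apply/negP => /SE/(prime_set1 QP).
  move=> a x y /SE Qx /SE Qy; apply/SE.
  by apply: prime_setD => //; apply: prime_setM.
have Spr : prime_idealr_closed S.
  by move=> x y /SE/(prime_setP QP) Qxy; apply/orP; case: Qxy => /SE; [left|right].
pose m1 := isIdealr.Build R S Sid; pose m2 := isPrimeIdealrClosed.Build R S Spr.
pose P : prime_idealr R := HB.pack S m1 m2.
by exists P.
Qed.

Lemma prime_set_prime_idealr (R : comNzRingType) (P : prime_idealr R) :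
  prime_set (fun x => x \in P).
Proof.
split; first exact: idealr0.
- by rewrite idealr1.
- by move=> x y; apply: rpredD.
- by move=> x y; apply: idealMr.
- by move=> x y; rewrite prime_idealrM => /orP.
Qed.

Local Open Scope quotient_scope.

Section LocalizedQuotient.
Variables (S : comNzRingType) (I : idealr S) (P : prime_idealr {ideal_quot I}).
Implicit Types (a b u : S) (x y : localization P).

Let Q a : Prop := \pi_{ideal_quot I} a \in P.

Definition to_loc a : localization P :=
  \pi_(localization P) (mkfrac (\pi_{ideal_quot I} a) (locfrac_den1 P)).

Lemma to_loc0 : to_loc 0 = 0.
Proof. by apply: loc_eq; rewrite /= rmorph0. Qed.

Lemma to_loc1 : to_loc 1 = 1.
Proof. by apply: loc_eq; rewrite /= rmorph1. Qed.

Lemma to_locD a b : to_loc (a + b) = to_loc a + to_loc b.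
Proof.
by rewrite [RHS]loc_addE; apply: loc_eq; rewrite /= rmorphD /= !mulr1.
Qed.

Lemma to_locM a b : to_loc (a * b) = to_loc a * to_loc b.
Proof.
by rewrite [RHS]loc_mulE; apply: loc_eq; rewrite /= rmorphM /= !mulr1.
Qed.

Lemma to_locB a b : to_loc (a - b) = to_loc a - to_loc b.
Proof. by apply/eqP; rewrite eq_sym subr_eq -to_locD subrK. Qed.

Lemma to_loc_eq0 a : to_loc a = 0 <-> exists2 u, ~ Q u & u * a \in I.
Proof.
have piI b : \pi_{ideal_quot I} b = 0 <-> b \in I.
  by have := Quotient.idealrBE I b 0; rewrite subr0 rmorph0 => ->; split=> /eqP.
split=> [/eqP/loc_eqP[v vP]|[u uQ uaI]].
  rewrite /= !mulr1 subr0; elim/quotW: v vP => v vP e; exists v; first exact/negP.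
  by apply/piI; rewrite rmorphM.
apply/eqP/loc_eqP; exists (\pi_{ideal_quot I} u); first exact/negP.
by rewrite /= !mulr1 subr0 -rmorphM; apply/piI.
Qed.

Lemma to_loc_surj x : exists u a, ~ Q u /\ to_loc u * x = to_loc a.
Proof.
elim/quotW: x => -[[a s] /=]; elim/quotW: a => a; elim/quotW: s => s sP.
exists s, a; split; first exact/negP.
by rewrite [LHS]loc_mulE; apply: loc_eq => /=; ring.
Qed.

Lemma to_loc_inv u : ~ Q u -> exists y, y * to_loc u = 1.
Proof.
move=> /negP uP; exists (\pi_(localization P) (mkfrac 1 uP)).
rewrite [LHS]loc_mulE; apply: loc_eq => /=; ring.
Qed.

Lemma prime_set_loc : prime_set Q.
Proof.
split; rewrite /Q.
- by rewrite rmorph0 idealr0.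
- by rewrite rmorph1 idealr1.
- by move=> a b; rewrite rmorphD; apply: rpredD.
- by move=> a b; rewrite rmorphM; apply: idealMr.
- by move=> a b; rewrite rmorphM prime_idealrM => /orP.
Qed.

Lemma ideal_loc a : a \in I -> Q a.
Proof.
move=> aI; suff : \pi_{ideal_quot I} a = 0 by rewrite /Q => ->; apply: idealr0.
by rewrite -(rmorph0 \pi_{ideal_quot I}); apply/eqP; rewrite -Quotient.idealrBE subr0.
Qed.

Lemma to_loc_nonunit (s : seq (localization P)) :
    (forall x, x \in s -> exists2 a, Q a & x = to_loc a) ->
  1 \notin ideal_gen (fun x => x \in s).
Proof.
move=> sQ; apply/negP.
(* The maximal ideal of the localization: fractions with numerator in Q. *)
pose M x := exists u a, [/\ ~ Q u, Q a & to_loc u * x = to_loc a].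
have QP := prime_set_loc.
have M0 : M 0 by exists 1, 0; split; rewrite ?mulr0 ?to_loc0 //;
  [exact: (prime_set1 QP)|exact: (prime_set0 QP)].
have MD x y : M x -> M y -> M (x + y).
  move=> [u [a [uQ aQ ea]]] [v [b [vQ bQ eb]]]; exists (u * v), (v * a + u * b).
  split; first by case/(prime_setP QP).
    by apply: (prime_setD QP); apply: (prime_setM QP).
  by rewrite to_locD !to_locM -ea -eb; ring.
have MM x y : M y -> M (x * y).
  have [u [a [uQ ea]]] := to_loc_surj x; move=> [v [b [vQ bQ eb]]].
  exists (u * v), (a * b); split; first by case/(prime_setP QP).
    exact: (prime_setM QP).
  by rewrite !to_locM -ea -eb; ring.
suff : ~ M 1.
  move=> M1 /asboolP[t [tP e1]]; apply: M1; rewrite [X in M X]e1 big_seq.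
  apply: (big_ind M) => // p /tP/sQ[a Qa ->]; apply: MM.
  by exists 1, a; split; rewrite ?to_loc1 ?mul1r //; apply: (prime_set1 QP).
move=> [u [a [uQ Qa]]]; rewrite mulr1 => /eqP; rewrite -subr_eq0 -to_locB => /eqP.
move/to_loc_eq0 => [v vQ /ideal_loc/(prime_setP QP)[//|Qua]]; apply: uQ.
by rewrite -[u](subrK a); apply: (prime_setD QP).
Qed.

Lemma to_loc_nonunitP a : Q a -> ~ exists y, y * to_loc a = 1.
Proof.
move=> Qa [y e]; have sQ x : x \in [:: to_loc a] -> exists2 a, Q a & x = to_loc a.
  by rewrite inE => /eqP ->; exists a.
have /negP := to_loc_nonunit sQ; apply; rewrite -e.
apply/asboolP; exists [:: (y, to_loc a)]; split; last by rewrite big_seq1.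
by move=> p; rewrite inE => /eqP ->; rewrite mem_head.
Qed.

Lemma prime_set_pullback (p : prime_idealr (localization P)) :
  [/\ prime_set (fun a => to_loc a \in p), forall a, a \in I -> to_loc a \in p
    & forall a, to_loc a \in p -> Q a].
Proof.
have pP := prime_set_prime_idealr p; split.
- split.
  + by rewrite to_loc0 idealr0.
  + by rewrite to_loc1 idealr1.
  + by move=> a b; rewrite to_locD; apply: rpredD.
  + by move=> a b; rewrite to_locM; apply: idealMr.
  + by move=> a b; rewrite to_locM prime_idealrM => /orP.
- move=> a aI; suff -> : to_loc a = 0 by apply: idealr0.
  by apply/to_loc_eq0; exists 1; rewrite ?mul1r //; apply: (prime_set1 prime_set_loc).
- move=> a pa; apply: contrapT => /to_loc_inv[y e].
  by apply: (prime_set1 pP); rewrite -e idealMr.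
Qed.

Lemma pullback_strict (p q : prime_idealr (localization P)) :
    (exists2 x, x \in q & x \notin p) ->
  exists2 a, to_loc a \in q & ~ to_loc a \in p.
Proof.
move=> [x xq xp]; have [u [a [uQ e]]] := to_loc_surj x; exists a.
  by rewrite -e idealMr.
have [_ _ pQ] := prime_set_pullback p.
by rewrite -e prime_idealrM (negPf xp) orbF => /pQ.
Qed.

Lemma prime_idealr_loc (Q' : S -> Prop) : prime_set Q' ->
    (forall a, a \in I -> Q' a) -> (forall a, Q' a -> Q a) ->
  exists p : prime_idealr (localization P), forall a, to_loc a \in p <-> Q' a.
Proof.
move=> Q'P Q'I Q'Q; have QP := prime_set_loc.
(* The extension of Q' to the localization; [ML] says that it contracts back to Q'. *)
pose M x := exists u a, [/\ ~ Q u, Q' a & to_loc u * x = to_loc a].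
have ML a : M (to_loc a) <-> Q' a.
  split=> [[u [b [uQ Q'b]]]|Q'a]; last first.
    by exists 1, a; split; rewrite ?to_loc1 ?mul1r //; apply: (prime_set1 QP).
  rewrite -to_locM => /eqP; rewrite -subr_eq0 -to_locB => /eqP/to_loc_eq0.
  move=> [v vQ /Q'I/(prime_setP Q'P)[/Q'Q//|]].
  move/(prime_setD Q'P)/(_ Q'b); rewrite subrK => /(prime_setP Q'P)[/Q'Q|//].
  by move/uQ.
have [|p pP] := @prime_idealr_of_prime_set _ M; last by exists p => a; rewrite pP.
split.
- by rewrite -to_loc0; apply/ML/(prime_set0 Q'P).
- by rewrite -to_loc1 => /ML/(prime_set1 Q'P).
- move=> x y [u [a [uQ aQ ea]]] [v [b [vQ bQ eb]]]; exists (u * v), (v * a + u * b).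
  split; first by case/(prime_setP QP).
    by apply: (prime_setD Q'P); apply: (prime_setM Q'P).
  by rewrite to_locD !to_locM -ea -eb; ring.
- move=> x y; have [u [a [uQ ea]]] := to_loc_surj x; move=> [v [b [vQ bQ eb]]].
  exists (u * v), (a * b); split; first by case/(prime_setP QP).
    exact: (prime_setM Q'P).
  by rewrite !to_locM -ea -eb; ring.
- move=> x y [w [c [wQ Q'c e]]].
  have [u [a [uQ ea]]] := to_loc_surj x; have [v [b [vQ eb]]] := to_loc_surj y.
  have : Q' (w * (a * b)).
    apply/ML; exists 1, (u * v * c); split; [exact: (prime_set1 QP)|exact: (prime_setM Q'P)|].
    by rewrite to_loc1 !to_locM -ea -eb -e; ring.
  move=> /(prime_setP Q'P)[/Q'Q//|/(prime_setP Q'P)[Q'a|Q'b]].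
    by left; exists u, a.
  by right; exists v, b.
Qed.

End LocalizedQuotient.

(** * Regular sequences of length at most two *)

Section DepthAtMostTwo.
Variable A : comNzRingType.
Implicit Types (f g x : A).

Lemma ideal_gen_nil x : x \in ideal_gen (fun y => y \in [::] : Prop) -> x = 0.
Proof.
move=> /asboolP[[|p s] [sP ->]]; first by rewrite big_nil.
by have := sP p (mem_head _ _).
Qed.

Lemma ideal_gen_seq1P x f : x \in ideal_gen (fun y => y \in [:: f] : Prop) <->
  exists c, x = c * f.
Proof.
split=> [/asboolP[s [sP ->]]|[c ->]].
  exists (\sum_(p <- s) p.1); rewrite mulr_suml big_seq [RHS]big_seq.
  by apply: eq_bigr => p /sP; rewrite inE => /eqP ->.
apply/asboolP; exists [:: (c, f)]; split; last by rewrite big_seq1.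
by move=> p; rewrite inE => /eqP->; rewrite mem_head.
Qed.

Lemma regular_sequence1 f :
    (forall a, a * f = 0 -> a = 0) -> 1 \notin ideal_gen (fun y => y \in [:: f] : Prop) ->
  regular_sequence [:: f].
Proof.
move=> fr f1; split=> // -[|//] _ a /ideal_gen_nil/fr ->; exact: ideal_gen0.
Qed.

Lemma regular_sequence2 f g : (forall a, a * f = 0 -> a = 0) ->
    (forall a c, a * g = c * f -> exists d, a = d * f) ->
    1 \notin ideal_gen (fun y => y \in [:: f; g] : Prop) ->
  regular_sequence [:: f; g].
Proof.
move=> fr gr fg1; split=> // -[|[|//]] _ a /=.
  by move=> /ideal_gen_nil/fr ->; exact: ideal_gen0.
by move=> /ideal_gen_seq1P[c /gr[d ->]]; apply/ideal_gen_seq1P; exists d.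
Qed.

Lemma regular_sequence2P f g : regular_sequence [:: f; g] ->
  (forall a, a * f = 0 -> a = 0) /\ (forall a c, a * g = c * f -> exists d, a = d * f).
Proof.
case=> reg _; split=> [a e|a c e].
  by apply/ideal_gen_nil/(reg 0%N) => //=; rewrite e; apply: ideal_gen0.
by apply/ideal_gen_seq1P/(reg 1%N) => //=; apply/ideal_gen_seq1P; exists c.
Qed.

End DepthAtMostTwo.

(** * The two implications *)

Section Sufficiency.
Variables (K : fieldType) (n : nat) (D : simplicial_complex n).
Hypothesis hpure : pure D.
Let I := symbolic_square K D.
Variable P : prime_idealr {ideal_quot I}.
Let Q (f : {mpoly K[n]}) : Prop := \pi_{ideal_quot I} f \in P.
Let w : {mpoly K[n]} := (\prod_(i in invertible_vars Q) 'X_i) ^+ 2.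

Let QP : prime_set Q := prime_set_loc P.

Let w_cancel a : w * a \in I -> to_loc P a = 0.
Proof. by move=> waI; apply/to_loc_eq0; exists w; [exact: (invertible_prod QP)|]. Qed.

Lemma depth_ge0_loc : depth_ge (localization P) 0.
Proof.
exists [tuple]; split=> //; split=> //.
by apply: to_loc_nonunit.
Qed.

Let regular1 f x :
    (forall G, G \in facets D -> invertible_vars Q \subset G -> ~ Ppow G 1 f) ->
  x * to_loc P f = 0 -> x = 0.
Proof.
move=> fP xf0; have [u [a [uQ e]]] := to_loc_surj x.
have [y yu] := to_loc_inv uQ.
suff a0 : to_loc P a = 0 by rewrite -[x]mul1r -yu -mulrA e a0 mulr0.
have /to_loc_eq0[t tQ taf] : to_loc P (f * a) = 0.
  by rewrite to_locM -e mulrC -mulrA xf0 mulr0.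
exact: w_cancel (weakly_regular1 QP fP tQ taf).
Qed.

Lemma depth_ge1_loc : krull_dim_ge (localization P) 1 -> depth_ge (localization P) 1.
Proof.
move=> [p pP]; have [_ /pullback_strict[f1 f1q f1p]] := pP ord0 ord_max isT.
have [Q0P Q0I Q0Q] := prime_set_pullback (p ord0).
have [_ _ Q1Q] := prime_set_pullback (p ord_max).
have [f Qf fP] := regular_element hpure QP Q0P Q0I Q0Q (Q1Q _ f1q) f1p.
exists [tuple to_loc P f]; split.
  by move=> x; rewrite inE => /eqP ->; apply: to_loc_nonunitP.
apply: regular_sequence1 => [a|]; first exact: regular1.
by apply: to_loc_nonunit => x; rewrite inE => /eqP ->; exists f.
Qed.

Hypothesis diam2 : forall F, F \in faces D -> 1 <= complex_dim (link D F) ->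
  skeleton_diam_le (link D F) 2.

Lemma depth_ge2_loc : krull_dim_ge (localization P) 2 -> depth_ge (localization P) 2.
Proof.
move=> [p pP]; pose i1 : 'I_3 := lift ord0 ord0.
have [Q01 /pullback_strict[f1 f1q f1p]] := pP ord0 i1 isT.
have [Q12 /pullback_strict[g1 g1q g1p]] := pP i1 ord_max isT.
have [Q0P Q0I _] := prime_set_pullback (p ord0).
have [Q1P _ Q1Q] := prime_set_pullback (p i1).
have [_ _ Q2Q] := prime_set_pullback (p ord_max).
have [f [g [Qf Qg fg codim1]]] := regular_pair hpure QP Q0P Q0I Q1P
  (fun a => Q01 (to_loc P a)) Q1Q f1q f1p (Q2Q _ g1q) g1p.
have fgQ x : x \in [:: to_loc P f; to_loc P g] -> exists2 a, Q a & x = to_loc P a.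
  by rewrite !inE => /orP[]/eqP->; [exists f|exists g].
exists [tuple to_loc P f; to_loc P g]; split.
  by move=> x /fgQ[a Qa ->]; apply: to_loc_nonunitP.
apply: regular_sequence2 => [a|x c e|]; last exact: to_loc_nonunit.
  by apply: regular1 => G GD FG; have [f0 _] := fg G GD FG; move/hpart0_eq0/eqP; apply/negP.
(* Clear denominators: x = a/u and c = b/v turn the relation into one between polynomials. *)
have [u [a [uQ ea]]] := to_loc_surj x; have [v [b [vQ eb]]] := to_loc_surj c.
have /to_loc_eq0[t tQ tI] : to_loc P (g * (v * a) - f * (u * b)) = 0.
  rewrite to_locB !to_locM -ea -eb; apply/eqP; rewrite subr_eq0; apply/eqP.
  transitivity (to_loc P u * to_loc P v * (x * to_loc P g)); first by ring.
  by rewrite e; ring.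
have [q /w_cancel] := weakly_regular2 hpure QP diam2 fg codim1 tQ tI.
rewrite to_locB => /eqP; rewrite subr_eq0 => /eqP eq.
have [y yu] := to_loc_inv uQ; have [z zv] := to_loc_inv vQ.
(* From v a = f q, the quotient of x = a/u by f is q/(u v). *)
exists (y * z * to_loc P q).
transitivity (y * z * to_loc P (v * a)); last by rewrite eq to_locM; ring.
rewrite to_locM -ea -[LHS]mul1r -[1](mulr1 1) -{1}yu -zv; ring.
Qed.

End Sufficiency.

(** * (S_2) implies the diameter condition *)

Section Necessity.
Variables (K : fieldType) (n : nat) (D : simplicial_complex n).
Let I := symbolic_square K D.
Variables (F : {set 'I_n}).
Hypothesis FD : F \in faces D.
Let Q : {mpoly K[n]} -> Prop := Ppow F 1.
Let QP : prime_set Q := Ppow_prime K F.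

Lemma symbolic_square_Ppow E f : E \in faces D -> f \in I -> Ppow E 1 f.
Proof.
move=> ED /symbolic_squareP fI; have [G GD EG] := face_in_facet ED.
exact: PpowS EG (Ppow_leq (leqnSn 1) (fI G GD)).
Qed.

Lemma invertible_vars_face : invertible_vars Q = F.
Proof.
apply/setP => i; rewrite inE; apply/asboolP/idP => [nQ|iF].
  by apply/negPn/negP => /(@PpowXU K)/nQ.
by move/(_ U_(i)%MM); rewrite outdeg1 iF mcoeffX eqxx => /(_ isT)/eqP; rewrite oner_eq0.
Qed.

Lemma prime_idealr_quot : exists P : prime_idealr {ideal_quot I},
  forall f, \pi_{ideal_quot I} f \in P <-> Q f.
Proof.
pose X (x : {ideal_quot I}) := exists2 f, Q f & x = \pi_{ideal_quot I} f.
have XE f : X (\pi_{ideal_quot I} f) <-> Q f.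
  split=> [[g Qg /eqP]|]; last by exists f.
  rewrite -Quotient.idealrBE => /(symbolic_square_Ppow FD) fg.
  by rewrite -[f](subrK g); apply: (prime_setD QP).
have [|P PP] := @prime_idealr_of_prime_set _ X; last by exists P => f; rewrite PP.
split.
- by rewrite -(rmorph0 \pi_{ideal_quot I}); apply/XE/(prime_set0 QP).
- by rewrite -(rmorph1 \pi_{ideal_quot I}) => /XE/(prime_set1 QP).
- move=> _ _ [f Qf ->] [g Qg ->]; rewrite -rmorphD; apply/XE.
  exact: (prime_setD QP).
- move=> x _ [g Qg ->]; elim/quotW: x => f; rewrite -rmorphM; apply/XE.
  exact: (prime_setM QP).
- move=> x y; elim/quotW: x => f; elim/quotW: y => g.
  by rewrite -rmorphM => /XE/(prime_setP QP)[]Qz; [left|right]; apply/XE.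
Qed.

Variable P : prime_idealr {ideal_quot I}.
Hypothesis PE : forall f, \pi_{ideal_quot I} f \in P <-> Q f.

(** For distinct x and y in a face of the link, the chain consists of the ideals of the faces
    obtained from F by adding x and y, adding x, and adding nothing. *)
Lemma krull_dim_ge2_loc : 1 <= complex_dim (link D F) -> krull_dim_ge (localization P) 2.
Proof.
move=> /complex_dim_linkP[H /in_linkP[HFD HF0] /card_gt1P[x [y [xH yH xy]]]].
have HF z : z \in H -> z \notin F.
  by move=> zH; apply/negP => zF; have := in_set0 z; rewrite -HF0 inE zH zF.
have primeE E : E \in faces D -> F \subset E ->
    exists p : prime_idealr (localization P), forall a, to_loc P a \in p <-> Ppow E 1 a.
  move=> ED FE; apply: prime_idealr_loc; first exact: Ppow_prime.
    by move=> a; apply: symbolic_square_Ppow.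
  by move=> a aE; apply/PE; apply: PpowS aE.
have subE : [/\ F \subset x |: F & x |: F \subset y |: (x |: F)] by rewrite !subsetUr.
have yxFD : y |: (x |: F) \in faces D.
  apply: faces_sub HFD _; rewrite !subUset !sub1set !inE xH yH /=.
  exact: subsetUr.
case: subE => Fx xyF.
have [p0 p0P] := primeE _ yxFD (subset_trans Fx xyF).
have [p1 p1P] := primeE _ (faces_sub yxFD xyF) Fx.
have [p2 p2P] := primeE _ FD (subxx F).
have sub (p q : prime_idealr (localization P)) E E' :
    (forall a, to_loc P a \in p <-> Ppow E 1 a) ->
    (forall a, to_loc P a \in q <-> Ppow E' 1 a) -> E' \subset E -> {subset p <= q}.
  move=> pP qP E'E z; have [u [a [uQ e]]] := to_loc_surj z.
  move=> zp; have /pP aE : to_loc P a \in p by rewrite -e idealMr.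
  have /qP : Ppow E' 1 a := PpowS E'E aE.
  have [_ _ qQ] := prime_set_pullback q.
  by rewrite -e prime_idealrM => /orP[/qQ|].
have strict (p q : prime_idealr (localization P)) E E' z :
    (forall a, to_loc P a \in p <-> Ppow E 1 a) ->
    (forall a, to_loc P a \in q <-> Ppow E' 1 a) -> z \in E -> z \notin E' ->
    exists2 x, x \in q & x \notin p.
  move=> pP qP zE zE'; exists (to_loc P 'X_z); first exact/qP/PpowXU.
  apply/negP => /pP/(_ U_(z)%MM); rewrite outdeg1 zE mcoeffX eqxx => /(_ isT)/eqP.
  by rewrite oner_eq0.
exists (fun i : 'I_3 => if val i == 0%N then p0 else if val i == 1%N then p1 else p2).
move=> [[|[|[|//]]] ?] [[|[|[|//]]] ?] //= _; split.
- exact: sub p0P p1P xyF.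
- by apply: strict p0P p1P (setU11 _ _) _; rewrite in_setU1 negb_or eq_sym xy HF.
- exact: sub p0P p2P (subset_trans Fx xyF).
- by apply: strict p0P p2P (setU11 _ _) _; rewrite HF.
- exact: sub p1P p2P Fx.
- by apply: strict p1P p2P (setU11 _ _) _; rewrite HF.
Qed.

(** Multiplying the members of a regular pair by units clears their denominators and preserves
    regularity. *)
Lemma depth_ge2_witness : depth_ge (localization P) 2 -> exists f g : {mpoly K[n]},
  [/\ Q f, Q g, forall x, x * to_loc P f = 0 -> x = 0 &
    forall x y, x * to_loc P g = y * to_loc P f -> exists z, x = z * to_loc P f].
Proof.
case=> -[[|f0 [|g0 [|? ?]]] // ?] [/= sN reg].
have [reg1 reg2] := regular_sequence2P reg.
have lift x : x \in [:: f0; g0] -> exists f y z,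
    [/\ Q f, z * y = 1 & to_loc P f = y * x].
  move=> xs; have [u [a [uQ e]]] := to_loc_surj x; have [y yu] := to_loc_inv uQ.
  exists a, (to_loc P u), y; split=> //; apply/PE; apply: contrapT => aQ.
  have [z za] := to_loc_inv aQ; apply: (sN x xs); exists (z * to_loc P u).
  by rewrite -mulrA e.
have [f [c [c' [Qf cc ef]]]] := lift f0 (mem_head _ _).
have [|g [d [d' [Qg dd eg]]]] := lift g0; first by rewrite !inE eqxx orbT.
exists f, g; split=> // [x|x y]; rewrite ef.
  move=> e; apply: reg1; transitivity (c' * (x * (c * f0))); last by rewrite e mulr0.
  by rewrite -[LHS]mul1r -cc; ring.
rewrite eg => e; have [|z ez] := reg2 (x * d) (y * c); first by rewrite -!mulrA.
exists (z * d' * c'); transitivity (d' * (x * d)).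
  by rewrite -[LHS]mul1r -dd; ring.
rewrite ez; transitivity (c' * c * (d' * (z * f0))); first by rewrite cc mul1r.
ring.
Qed.

Variables u v : 'I_n.
Hypotheses (uL : [set u] \in link D F) (vL : [set v] \in link D F).
Hypothesis far : ~ exists p : seq 'I_n,
  [/\ path (skeleton_edge (link D F)) u p, last u p = v & (size p <= 2)%N].

Let notF x : [set x] \in link D F -> x \notin F.
Proof.
move=> /in_linkP[_ /setP/(_ x)]; rewrite !inE eqxx /= => ->; by [].
Qed.

Let edgeI x y G : G \in facets D -> F \subset G -> x \in G -> y \in G ->
  x \notin F -> y \notin F -> x != y -> skeleton_edge (link D F) x y.
Proof.
move=> GD FG xG yG xF yF xy; rewrite /skeleton_edge /= xy; apply/in_linkP; split.
  by apply: faces_sub (facets_faces GD) _; rewrite !subUset !sub1set xG yG.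
apply/setP => i; rewrite !inE; apply/negP => /andP[/orP[]/eqP->]; exact/negP.
Qed.

Let uF : u \notin F := notF uL.
Let vF : v \notin F := notF vL.

Let uv : u != v.
Proof. by apply/eqP => e; apply: far; exists [::]. Qed.

Let no_edge : ~~ skeleton_edge (link D F) u v.
Proof. by apply/negP => e; apply: far; exists [:: v]; rewrite /= e. Qed.

Let no_path2 x : skeleton_edge (link D F) u x -> ~~ skeleton_edge (link D F) x v.
Proof. by move=> ux; apply/negP => xv; apply: far; exists [:: x; v]; rewrite /= ux xv. Qed.

Let not_both G : G \in facets D -> F \subset G -> u \in G -> v \notin G.
Proof.
by move=> GD FG uG; apply: contraNN no_edge => vG; apply: edgeI uG vG uF vF uv.
Qed.

(* Multiplication by f maps the section "x_u x_v on the facets containing u,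
   0 on those containing v" into S/I: keep in f the monomials divisible by a
   neighbour of u. *)
Lemma multiply_section f : Q f -> exists h : {mpoly K[n]},
  (forall G, G \in facets D -> F \subset G -> v \in G -> Ppow G 2 h) /\
  (forall G, G \in facets D -> F \subset G -> v \notin G ->
     Ppow G 2 (h - f * ('X_u * 'X_v))).
Proof.
move=> Qf; pose near (m : 'X_{1..n}) := [exists x, [&& x \notin F, (0 < m x)%N &
  (x == u) || skeleton_edge (link D F) u x]].
have XP (G : {set 'I_n}) x : x \notin G -> Ppow G 1 ('X_x : {mpoly K[n]}) by apply: PpowXU.
exists (mcut near f * ('X_u * 'X_v)); split=> G GD FG vG.
  rewrite mulrA; apply: PpowMr; apply: (@PpowM _ _ G 1 1); last first.
    by apply: XP; apply/negP => uG; have := not_both GD FG uG; rewrite vG.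
  move=> m; rewrite ltnS leqn0 mcoeff_mcut outdeg_eq0 => /forall_inP mG.
  (* If m had outside degree 0 at G, the vertex x would lie in G together with v: either x = u, or
     u, x, v is a path of length 2. *)
  case: ifP => // /existsP[x /and3P[xF mx xu]].
  have xG : x \in G.
    by apply/negPn/negP => xG; move: mx; rewrite (eqP (mG x xG)).
  case/orP: xu => [/eqP xu|ux]; first by move: (not_both GD FG); rewrite -xu xG vG => /(_ isT).
  case/negP: (no_path2 ux); apply: edgeI GD FG xG vG xF vF _.
  by apply: contraTneq ux => ->.
rewrite -mulrBl; have [uG|uG] := boolP (u \in G); last first.
  by apply: PpowMl; apply: (@PpowM _ _ G 1 1); apply: XP.
rewrite mulrA mulrAC; apply: PpowMr; apply: (@PpowM _ _ G 1 1); last exact: XP.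
move=> m; rewrite ltnS leqn0 outdeg_eq0 mcoeffB mcoeff_mcut => /forall_inP mG.
case: ifP => [_|nm]; first by rewrite subrr.
(* A monomial dropped from f, which lies in P_F, contains a variable outside F; that variable is not
   in G, or it would be u or a neighbour of u. *)
rewrite Qf ?subr0 // ltnS leqn0 outdeg_eq0; apply/forall_inP => x xF.
rewrite -leqn0 leqNgt; apply/negP => mx.
have xG : x \in G by apply/negPn/negP => xG; move: mx; rewrite (eqP (mG x xG)).
case/negP: (negbT nm); apply/existsP; exists x; rewrite xF mx /=.
by have [//|xu] := eqVneq x u; apply: edgeI GD FG uG xG uF xF _; rewrite eq_sym.
Qed.

(** Write h_f and h_g for the products of f and g with the section of [multiply_section]. Then h_f g
    = h_g f, so regularity makes h_f = z f with z in the localization. Cancelling f on each facet, z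
    = t/s would be the section itself, which forces s into P_F. *)
Lemma no_regular_pair (f g : {mpoly K[n]}) : Q f -> Q g ->
    (forall x, x * to_loc P f = 0 -> x = 0) ->
    (forall x y, x * to_loc P g = y * to_loc P f -> exists z, x = z * to_loc P f) ->
  False.
Proof.
move=> Qf Qg reg1 reg2.
have loc0 a : (forall G, G \in facets D -> F \subset G -> Ppow G 2 a) -> to_loc P a = 0.
  move=> aP; apply/to_loc_eq0; exists ((\prod_(i in F) 'X_i) ^+ 2).
    by move/PE; rewrite -{1}invertible_vars_face; apply: (invertible_prod QP).
  by rewrite -{1}invertible_vars_face; apply: local_symbolic_square => G GD;
    rewrite invertible_vars_face; apply: aP.
have loc0P a G : to_loc P a = 0 -> G \in facets D -> F \subset G -> Ppow G 2 a.
  move=> /to_loc_eq0[t tQ /symbolic_squareP taI] GD FG.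
  apply: Ppow_primary (taI G GD) => tG; apply: tQ; apply/PE; exact: PpowS FG tG.
(* If f were in P_G, it would kill the square of the product of the variables of G times some x_j
   with j outside G, an element that is nonzero at G. *)
have fG G : G \in facets D -> F \subset G -> ~ Ppow G 1 f.
  move=> GD FG fG.
  have [j jG] : exists j, j \notin G.
    have [uG|uG] := boolP (u \in G); last by exists u.
    by exists v; apply: not_both.
  have XG : ~ Ppow G 1 (\prod_(i in G) 'X_i : {mpoly K[n]}).
    apply: (prime_set_prod (Ppow_prime K G)) => i iG /(_ U_(i)%MM).
    by rewrite outdeg1 iG mcoeffX eqxx => /(_ isT)/eqP; rewrite oner_eq0.
  pose c : {mpoly K[n]} := (\prod_(i in G) 'X_i) ^+ 2 * 'X_j.
  have /reg1/(loc0P c G)/(_ GD FG) : to_loc P c * to_loc P f = 0.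
    rewrite -to_locM; apply: loc0 => G' G'D FG'; have [GG'|GG'] := boolP (G \subset G').
      rewrite (facet_max GD (facets_faces G'D) GG') /c -mulrA; apply: PpowMl.
      by apply: (@PpowM _ _ G 1 1); first exact: PpowXU.
    by apply: PpowMr; apply: PpowMr; apply: prod_facet_Ppow.
  rewrite /c expr2 -mulrA => /(Ppow_primary XG)/(Ppow_primary XG)/(_ U_(j)%MM).
  by rewrite outdeg1 jG mcoeffX eqxx => /(_ isT)/eqP; rewrite oner_eq0.
have [hf [hfv hfu]] := multiply_section Qf; have [hg [hgv hgu]] := multiply_section Qg.
have [|z ez] := reg2 (to_loc P hf) (to_loc P hg).
  rewrite -!to_locM; apply/eqP; rewrite -subr_eq0 -to_locB; apply/eqP/loc0 => G GD FG.
  have [vG|vG] := boolP (v \in G).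
    by apply: PpowB; apply: PpowMr; [apply: hfv|apply: hgv].
  have -> : hf * g - hg * f =
      g * (hf - f * ('X_u * 'X_v)) - f * (hg - g * ('X_u * 'X_v)) by ring.
  by apply: PpowB; apply: PpowMl; [apply: hfu|apply: hgu].
have [s [t [sQ est]]] := to_loc_surj z.
have stP G : G \in facets D -> F \subset G -> Ppow G 2 (s * hf - t * f).
  by apply: loc0P; rewrite to_locB !to_locM ez -est; ring.
have inG x : [set x] \in link D F -> exists G, [/\ G \in facets D, F \subset G & x \in G].
  move=> /in_linkP[xFD _]; have [G GD] := face_in_facet xFD.
  by rewrite subUset sub1set => /andP[xG FG]; exists G.
have [G [GD FG uG]] := inG u uL; have [G' [G'D FG' vG']] := inG v vL.
have vG := not_both GD FG uG.
have uG' : u \notin G' by apply/negP => uG'; have := not_both G'D FG' uG'; rewrite vG'.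
have tG' : Ppow G' 2 t.
  apply: (Ppow_primary (fG G' G'D FG')); rewrite mulrC.
  have -> : t * f = s * hf - (s * hf - t * f) by ring.
  by apply: PpowB; [apply/PpowMl/hfv|apply: stP].
have tG : Ppow G 2 (s * 'X_[U_(u) + U_(v)] - t).
  apply: (Ppow_primary (fG G GD FG)); rewrite mpolyXD.
  have -> : f * (s * ('X_u * 'X_v) - t) =
      (s * hf - t * f) - s * (hf - f * ('X_u * 'X_v)) by ring.
  by apply: PpowB; [apply: stP|apply/PpowMl/hfu].
apply: sQ; apply/PE => m m0; have mE (E : {set 'I_n}) : F \subset E -> outdeg E m = 0%N.
  by move=> FE; apply/eqP; rewrite -leqn0 (leq_trans (leq_odeg m FE)).
(* The monomial x_u x_v x^m has outside degree 1 at both G and G'. Its coefficient in t is 0 by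
   [tG'], and by [tG] it equals the coefficient of x^m in s. *)
have := tG (U_(u) + U_(v) + m)%MM; rewrite mcoeffB mcoeffMX tG'; last first.
  by rewrite !outdegD !outdeg1 uG' vG' mE.
by rewrite subr0; apply; rewrite !outdegD !outdeg1 uG vG mE.
Qed.

End Necessity.

Theorem corollary3p3 (K : fieldType) (n : nat) (D : simplicial_complex n)
    (hpure : pure D) :
  serre_condition 2 {ideal_quot (symbolic_square K D)}
  <->
  (forall F : {set 'I_n}, F \in faces D -> 1 <= complex_dim (link D F) ->
     skeleton_diam_le (link D F) 2).
Proof.
split=> [S2 F FD dimF u v uL vL|diam2 P d].
  apply: contrapT => far; have [P PE] := prime_idealr_quot K FD.
  have dim2 := krull_dim_ge2_loc FD PE dimF.
  have [f [g [Qf Qg reg1 reg2]]] := depth_ge2_witness PE (S2 P 2%N isT dim2).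
  by case: (no_regular_pair PE uL vL far Qf Qg reg1 reg2).
case: d => [|[|[|//]]] _; first by move=> _; apply: depth_ge0_loc.
  exact: depth_ge1_loc.
exact: depth_ge2_loc.
Qed.
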